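(* Let $K$ be a euclidean ordered field, $E$ a $2$-dimensional $K$-vector space with a positive definite symmetric bilinear form, and $i\in E$ a vector with $i\cdot i=1$. Then the set $\mathcal H=\{u\in E: -2\,i\cdot u>0\}$, with the lines, betweenness, segments, rays, angles and congruence defined in the context, satisfies the Hilbert axioms of incidence, order and congruence together with the hyperbolic version of the parallel axiom (rather than the classical Euclidean parallel postulate), namely: (Incidence 1) For every pair of distinct points $u,v$ there is a unique line containing both $u$ and $v$. (Incidence 2) Every line contains at least two points. (Incidence 3) There are at least three points that are not collinear. (Order 1) For three distinct collinear points $u,v,w$, if $w$ is between $u$ and $v$, then $w$ is also between $v$ and $u$. (Order 2) For any three distinct collinear points $u,v,w$, exactly one point is between the other two points. (Order 3) For any two distinct points $s,t$, there are at least three points $u,v,w$ on the line passing through $s$ and $t$ such that $s$ is between $u$ and $t$, $v$ is between $s$ and $t$, and $t$ is between $s$ and $w$. (Order 4, Pasch) Let $u,v,w$ be three distinct points and let $M$ be a line that does not pass through any of these three points. If $M$ passes through a point between $u$ and $v$, then $M$ also passes through a point either between $u$ and $w$, or between $v$ and $w$. (Congruence 1) A segment is congruent to itself. If two segments are congruent to a third one, they are congruent to each other. (Congruence 2) An angle is congruent to itself. If two angles are congruent to a third one, they are congruent to each other. (Congruence 3) Let $u,v$ be two distinct points. If $w$ is any point and $L$ is any line passing through $w$, there is on each side of $w$ in $L$ a unique point $t$ such that the segment $[w,t]$ is congruent to the segment $[u,v]$. (Congruence 4) On a line $L$ let $[u,v]$ and $[v,w]$ be two segments with only the point $v$ in common.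 Suppose on a line $M$ there are segments $[x,y]$ and $[y,z]$ with only the point $y$ in common that are congruent to $[u,v]$ and $[v,w]$ respectively. Then the segment $[u,w]$ is congruent to the segment $[x,z]$. (Congruence 5) Let $\alpha$ be an angle defined by two rays $R$ and $S$. Let $T$ be a ray that is part of a line $L$. There is on each side of the line $L$ a unique ray making an angle with $T$ that is congruent to the angle $\alpha$. (Congruence 6, side-angle-side) Let $u,v,w$ and $x,y,z$ be two sets of three non-collinear points. If the segments $[u,v]$ and $[u,w]$ are congruent to the segments $[x,y]$ and $[x,z]$ respectively, and the angle determined by the rays $[uv,\infty)$ and $[uw,\infty)$ is congruent to the angle determined by the rays $[xy,\infty)$ and $[xz,\infty)$, then there is a congruence transformation mapping $u,v,w$ to $x,y,z$ respectively. (Parallel axiom, hyperbolic version) Let $L$ be a line in $\mathcal H$ and let $u\in\mathcal H$ be a point not on $L$. There are two or more (in fact infinitely many) lines passing through $u$ that do not intersect $L$.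
   Context: A euclidean ordered field is an ordered field in which every positive element is a square. The positive definite form on $E$ is written $x\cdot y$. Cycles: $\mathcal F$ is the $4$-dimensional $K$-vector space of all functions $E\to K$ of the form $X\mapsto a\,X\cdot X+b\cdot X+c$ with $a,c\in K$, $b\in E$; its elements are called cycles. The cycle pairing on $\mathcal F$ is the non-degenerate symmetric bilinear form $\langle aX\cdot X+b\cdot X+c,\ a^*X\cdot X+b^*\cdot X+c^*\rangle=b\cdot b^*-2ac^*-2a^*c$. ''Orthogonal'' for cycles means orthogonal for this pairing; a cycle $m$ is nonisotropic if $\langle m,m\rangle\neq0$. For $u\in E$ put $q(u)=X\cdot X-2u\cdot X+u\cdot u\in\mathcal F$. Let $p\in\mathcal F$ be the cycle $p(X)=i\cdot X$; so $\langle p,p\rangle=1$ and $\mathcal H=\{u\in E:\langle p,q(u)\rangle>0\}$. ''Points'' are elements of $\mathcal H$. Lines: a line in $\mathcal H$ is a nonempty subset of the form $\{u\in\mathcal H:\langle m,q(u)\rangle=0\}$ for some nonisotropic cycle $m$ with $\langle m,p\rangle=0$. The two sides of this line in $\mathcal H$ are the sets of $u\in\mathcal H$ with $\langle m,q(u)\rangle>0$, respectively $<0$. Points are collinear if some line contains all of them. Betweenness: for three distinct collinear points $u,v,w$ there is an equation $p=a\,q(u)+b\,q(v)+c\,q(w)$ with $a,b,c\in K$ all nonzero, and exactly two of $a,b,c$ have the same sign; the point corresponding to the remaining coefficient is said to lie between the other two. Segments and rays: the segment $[u,v]$ consists of $u$, $v$ and all points between $u$ and $v$. If $u$ is a point on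 a line $L$ defined by a cycle $\ell$, let $n$ be a nonzero cycle orthogonal to $p$, $q(u)$ and $\ell$ (it is nonisotropic and unique up to scalar); the two sides of $u$ in $L$ are the sets of $v\in L\setminus\{u\}$ with $\langle n,q(v)\rangle>0$, respectively $<0$. For $w\ne u$, the ray $[uw,\infty)$, issuing from $u$, is $u$ together with the side of $u$ containing $w$ in the line through $u$ and $w$. An angle is an ordered pair of rays issuing from the same point. Congruence: a proper transformation is an invertible linear map $T:\mathcal F\to\mathcal F$ preserving the cycle pairing, with $T(p)=p$, such that for every $u\in\mathcal H$ one has $T(q(u))=\lambda q(v)$ for some $\lambda>0$ in $K$ and some $v\in E$ (then $v\in\mathcal H$). The induced map $\mathcal H\to\mathcal H$, $u\mapsto v$, is called a congruence transformation. The segment $[u,v]$ is congruent to $[u',v']$ if there is a congruence transformation mapping $u$ to $u'$ and $v$ to $v'$. Two angles are congruent if there is a congruence transformation mapping the two rays of one to the two rays of the other, in the same order. *)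

(* Defs.v *)
From mathcomp Require Import all_boot all_order all_algebra.
From mathcomp Require Import boolp classical_sets functions cardinality.
From mathcomp Require Import ring.

Set Implicit Arguments.
Unset Strict Implicit.
Unset Printing Implicit Defensive.

Import Order.TTheory GRing.Theory Num.Theory.
Local Open Scope classical_set_scope.
Local Open Scope ring_scope.

Definition euclidean_field (K : realFieldType) : Prop :=
  forall x : K, 0 < x -> exists y : K, x = y ^+ 2.

(* The triple (a, b, c) stands for the cycle X |-> a X.X + b.X + c.  By
   [cycle_fun_linear] and [cycle_fun_inj] below, this identifies the space of
   triples with the vector space of functions of this form. *)
Notation cycle_of K E := (K^o * E * K^o)%type.

Section Cycles.
Context (K : realFieldType) (E : vectType K) (dot : {dot E for idfun}).

Definition cycle_fun (m : cycle_of K E) (X : E) : K :=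
  m.1.1 * dot X X + dot m.1.2 X + m.2.

Definition cycle_pairing (m n : cycle_of K E) : K :=
  dot m.1.2 n.1.2 - 2 * m.1.1 * n.2 - 2 * n.1.1 * m.2.

Definition nonisotropic (m : cycle_of K E) : Prop := cycle_pairing m m != 0.

Definition point_cycle (u : E) : cycle_of K E := (1, - 2 *: u, dot u u).

Lemma cycle_fun_linear (X : E) : scalar (cycle_fun^~ X).
Proof.
move=> a [[m1 m2] m3] [[n1 n2] n3]; rewrite /cycle_fun /= linearPl /=.
by rewrite /GRing.scale /=; ring.
Qed.

Lemma cycle_fun_inj (m n : cycle_of K E) :
  (exists X : E, X != 0) -> cycle_fun m =1 cycle_fun n -> m = n.
Proof.
move: m n => [[m1 m2] m3] [[n1 n2] n3] [X0 X0_neq0] eq_mn.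
have evE X : m1 * dot X X + dot m2 X + m3 = n1 * dot X X + dot n2 X + n3.
  exact: eq_mn.
have e3 : m3 = n3 by have := evE 0; rewrite !linear0r !mulr0 !add0r.
have eN X : m1 * dot X X - dot m2 X + m3 = n1 * dot X X - dot n2 X + n3.
  by have := evE (- X); rewrite !linearNr !linearNl opprK.
have two_neq0 : (2 : K) != 0 by rewrite pnatr_eq0.
have e1X X : m1 * dot X X = n1 * dot X X.
  apply: (mulfI two_neq0).
  have dbl (a b c : K) : 2 * a = (a + b + c) + (a - b + c) - 2 * c by ring.
  by rewrite (dbl _ (dot m2 X) m3) evE eN e3 -dbl.
have e1 : m1 = n1.
  by apply: (mulIf _ (e1X X0)); rewrite gt_eqF ?neq0_dnorm_gt0.
have e2 : m2 = n2.
  apply/eqP; rewrite -subr_eq0; apply/negPn/negP => /neq0_dnorm_gt0-/(_ _ dot).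
  rewrite linearBl /=; have := evE (m2 - n2); rewrite e1 e3.
  by move=> /addIr/addrI->; rewrite subrr ltxx.
by rewrite e1 e2 e3.
Qed.

Lemma cycle_fun_point_cycle (u X : E) :
  cycle_fun (point_cycle u) X = dot X X - 2 * dot u X + dot u u.
Proof. by rewrite /cycle_fun /= linearZl /= /GRing.scale /=; ring. Qed.

End Cycles.

Section PoincareHalfPlane.
Context (K : realFieldType) (E : vectType K) (dot : {dot E for idfun}) (i : E).

Notation cycleT := (cycle_of K E).
Notation "<< m , n >>" := (cycle_pairing dot m n).

Definition half_plane : Type := {u : E | 0 < - 2 * dot i u}.

Notation H := half_plane.

Implicit Types (u v w x y z s t : H) (L M D R S T X : set H).
Implicit Types (l m n : cycleT).

Definition horizon : cycleT := (0, i, 0).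
Notation p := horizon.

Lemma pairing_horizon_point_cycle (u : E) :
  << p, point_cycle dot u >> = - 2 * dot i u.
Proof.
by rewrite /cycle_pairing /= linearZr /= !(mulr0, mul0r, subr0).
Qed.

Definition q u : cycleT := point_cycle dot (val u).

Definition line_of_cycle m L : Prop :=
  [/\ nonisotropic dot m, << m, p >> = 0,
      L = [set u | << m, q u >> = 0] & L !=set0].

Definition is_line L : Prop := exists m, line_of_cycle m L.

Definition side_of_line L D : Prop :=
  exists2 m, line_of_cycle m L &
    D = [set u | 0 < << m, q u >>] \/ D = [set u | << m, q u >> < 0].

Definition collinear X : Prop := exists2 L, is_line L & X `<=` L.

Definition distinct3 u v w : Prop := [/\ u <> v, v <> w & u <> w].

(* The point lying between the other two is the middle argument. *)
Definition between u v w : Prop :=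
  [/\ distinct3 u v w, collinear [set u; v; w] &
      exists a b c : K,
        [/\ [/\ a != 0, b != 0 & c != 0],
            p = a *: q u + b *: q v + c *: q w,
            Num.sg a = Num.sg c & Num.sg b != Num.sg a]].

Definition segment u v : set H :=
  [set x | [\/ x = u, x = v | between u x v]].

Definition side_of_point_by L u n D : Prop :=
  D = [set v | [/\ L v, v <> u & 0 < << n, q v >>]] \/
  D = [set v | [/\ L v, v <> u & << n, q v >> < 0]].

Definition side_of_point L u D : Prop :=
  L u /\
  exists l n,
    [/\ line_of_cycle l L, n != 0,
        [/\ << n, p >> = 0, << n, q u >> = 0 & << n, l >> = 0] &
        side_of_point_by L u n D].

(* Meaningful for u <> w only *)
Definition ray u w : set H :=
  [set v | v = u \/
     exists L D, [/\ is_line L, L u /\ L w, side_of_point L u D, D w & D v]].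

Definition ray_from u R : Prop := exists2 w, w <> u & R = ray u w.

Definition is_angle R S : Prop := exists2 u, ray_from u R & ray_from u S.

Definition proper_transformation (T : {linear cycleT -> cycleT}) : Prop :=
  [/\ bijective T, forall m n, << T m, T n >> = << m, n >>, T p = p &
      forall u, exists (lambda : K) (v : E),
        0 < lambda /\ T (q u) = lambda *: point_cycle dot v].

Definition congruence_transformation (g : H -> H) : Prop :=
  exists2 T : {linear cycleT -> cycleT}, proper_transformation T &
    forall u, exists2 lambda : K, 0 < lambda & T (q u) = lambda *: q (g u).

(* [u, v] and [x, y] are given by ordered end points. *)
Definition segment_congruent u v x y : Prop :=
  exists2 g, congruence_transformation g & g u = x /\ g v = y.

Definition angle_congruent R S R' S' : Prop :=
  exists2 g, congruence_transformation g & g @` R = R' /\ g @` S = S'.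

Definition incidence1 : Prop :=
  forall u v, u <> v -> exists! L, is_line L /\ (L u /\ L v).

Definition incidence2 : Prop :=
  forall L, is_line L -> exists u v, [/\ L u, L v & u <> v].

Definition incidence3 : Prop :=
  exists u v w, distinct3 u v w /\ ~ collinear [set u; v; w].

Definition order1 : Prop :=
  forall u v w, distinct3 u v w -> collinear [set u; v; w] ->
    between u w v -> between v w u.

Definition order2 : Prop :=
  forall u v w, distinct3 u v w -> collinear [set u; v; w] ->
    [\/ [/\ between v u w, ~ between u v w & ~ between u w v],
        [/\ ~ between v u w, between u v w & ~ between u w v] |
        [/\ ~ between v u w, ~ between u v w & between u w v]].

Definition order3 : Prop :=
  forall s t L, s <> t -> is_line L -> L s -> L t ->
    exists u v w,
      [/\ distinct3 u v w, [/\ L u, L v & L w],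
          between u s t, between s v t & between s t w].

Definition order4 : Prop :=
  forall u v w M, distinct3 u v w -> is_line M -> ~ M u -> ~ M v -> ~ M w ->
    (exists2 x, M x & between u x v) ->
    exists2 x, M x & between u x w \/ between v x w.

(* A segment is a set of points, which may be presented by its end points in
   either order; hence the form of the reflexivity statement. *)
Definition congruence1 : Prop :=
  (forall u v x y, segment u v = segment x y -> segment_congruent u v x y) /\
  (forall u v u' v' x y,
     segment_congruent u v x y -> segment_congruent u' v' x y ->
     segment_congruent u v u' v').

Definition congruence2 : Prop :=
  (forall R S, is_angle R S -> angle_congruent R S R S) /\
  (forall R S R' S' R'' S'',
     is_angle R S -> is_angle R' S' -> is_angle R'' S'' ->
     angle_congruent R S R'' S'' -> angle_congruent R' S' R'' S'' ->
     angle_congruent R S R' S').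

Definition congruence3 : Prop :=
  forall u v w L D, u <> v -> is_line L -> L w -> side_of_point L w D ->
    exists! t, D t /\ segment_congruent w t u v.

Definition congruence4 : Prop :=
  forall L M u v w x y z, is_line L -> is_line M ->
    [/\ L u, L v & L w] -> [/\ M x, M y & M z] ->
    segment u v `&` segment v w = [set v] ->
    segment x y `&` segment y z = [set y] ->
    segment_congruent x y u v -> segment_congruent y z v w ->
    segment_congruent u w x z.

(* The vertex of a ray making an angle with T lies on L, so that the ray is not
   literally contained in a side D of L.  When the given angle is null or
   straight, the ray is moreover contained in L.  The first clause covers all
   angles, "on the side D" being understood as contained in the union of L and
   D; in the second clause the angle is neither null nor straight and the ray
   without its vertex w is contained in D. *)
Definition congruence5 : Prop :=
  forall R S w T L D, is_angle R S -> ray_from w T -> is_line L -> T `<=` L ->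
    side_of_line L D ->
    (exists! X, [/\ ray_from w X, angle_congruent T X R S & X `<=` L `|` D]) /\
    (~ collinear (R `|` S) ->
     exists! X, [/\ ray_from w X, angle_congruent T X R S & X `\ w `<=` D]).

Definition congruence6 : Prop :=
  forall u v w x y z,
    distinct3 u v w -> ~ collinear [set u; v; w] ->
    distinct3 x y z -> ~ collinear [set x; y; z] ->
    segment_congruent u v x y -> segment_congruent u w x z ->
    angle_congruent (ray u v) (ray u w) (ray x y) (ray x z) ->
    exists2 g, congruence_transformation g & [/\ g u = x, g v = y & g w = z].

Definition parallels_through L u : set (set H) :=
  [set M | [/\ is_line M, M u & M `&` L = set0]].

Definition hyperbolic_parallel : Prop :=
  forall L u, is_line L -> ~ L u ->
    (exists M N, [/\ parallels_through L u M, parallels_through L u N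
                    & M <> N]) /\
    infinite_set (parallels_through L u).

End PoincareHalfPlane.

(* Main.v *)
Require Import Defs.
From HB Require Import structures.
From mathcomp Require Import all_boot all_order all_algebra.
From mathcomp Require Import boolp classical_sets functions cardinality.
From mathcomp Require Import ring lra.

Set Implicit Arguments.
Unset Strict Implicit.
Unset Printing Implicit Defensive.

Import Order.TTheory GRing.Theory Num.Theory.
Local Open Scope classical_set_scope.
Local Open Scope ring_scope.

(** The proof passes from the half-plane to the hyperboloid model.  The cycles
    orthogonal to the horizon p form a 3-dimensional space of signature (2, 1).
    For a point u, the cycle h u = q u / <p, q u> - p lies in that space, has
    norm -1, and every cycle of norm -1 orthogonal to p is h u or - h u for
    exactly one point u ([h_inj], [point_of_pos]).  Moreover
    <h u, h v> = -1 - 2 |u - v|^2 / (<p, q u> <p, q v>), which is at most -1,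
    with equality for u = v only; this number plays the role of minus the
    hyperbolic cosine of the distance, and it separates the two sheets
    ([point_exists]).

    In these terms everything becomes linear.  A line is the trace of a plane
    through the origin ([lineP]), a point v is between u and w when h v is a
    combination of h u and h w with positive coefficients ([betweenP]), and a
    congruence transformation is the restriction of a linear isometry that
    preserves the sheet ([congruenceP]).  A ray is determined by its vertex u
    and by a unit vector d orthogonal to p and to h u: it consists of u and of
    the points v with h v = a h u + s d and s > 0 ([ray_fromP],
    [closed_ray_inj]).

    The incidence and order axioms are then statements on signs of coefficients
    and of pairings.  For the congruence axioms, reflections already move any
    two points to any two points with the same pairing
    ([two_point_transitivity]), so that congruence of segments is equality of
    pairings ([segment_congruentP]).  Adding segments is the addition formula
    for the hyperbolic cosine ([segment_addition]), and an angle is determined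
    by the pairing of its two unit vectors together with a side
    ([tangent_angle_unique]).  Finally, if l is the unit normal of a line that
    misses u, the line through u whose normal is the component of l tangent at
    u misses it too, and so do the lines through u whose normal is tilted a
    little from that one.  Square roots in K serve to normalize vectors. *)

(** * Preliminaries *)

Lemma sqrt_exists (K : realFieldType) (a : K) :
  euclidean_field K -> 0 <= a -> exists2 r : K, 0 <= r & r ^+ 2 = a.
Proof.
move=> K_euclidean; rewrite le_eqVlt => /predU1P[<-|a_gt0].
  by exists 0; rewrite ?expr0n.
by have [y ->] := K_euclidean a a_gt0; exists `|y|;
  rewrite ?real_normK ?num_real.
Qed.

Lemma sqr_inj_ge0 (K : realFieldType) (a b : K) :
  0 <= a -> 0 <= b -> a ^+ 2 = b ^+ 2 -> a = b.
Proof. by move=> a_ge0 b_ge0 ab; apply/eqP; rewrite -(@eqrXn2 _ 2) // ab. Qed.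

Lemma orthonormal_complement (K : realFieldType) (E : vectType K)
    (dot : {dot E for idfun}) (i : E) :
  euclidean_field K -> \dim {:E} = 2%N -> dot i i = 1 ->
  exists j : E, [/\ dot j j = 1, dot i j = 0 &
    forall x, x = dot i x *: i + dot j x *: j].
Proof.
move=> K_euclidean dimE ii.
have i0 : i != 0.
  apply/eqP => i0; move: ii.
  by rewrite i0 linear0l => /esym/eqP; rewrite oner_eq0.
have [e ei] : exists e : E, e \notin <[i]>%VS.
  have /subvPn[e _ ei] : ~~ (fullv <= <[i]>)%VS.
    by apply/negP => /dimvS; rewrite dimE dim_vline i0.
  by exists e.
have symd x y : dot x y = dot y x by rewrite hermC /= expr0 mul1r.
pose f := e - dot i e *: i.
have f0 : f != 0.
  by apply: contraNneq ei => /subr0_eq->; rewrite memvZ ?memv_line.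
have fi : dot i f = 0.
  by rewrite linearBr linearZr_LR /= ii mulr1 subrr.
have f_gt0 : 0 < dot f f by exact: neq0_dnorm_gt0.
have [r r_ge0 rE] := sqrt_exists K_euclidean (ltW f_gt0).
have r0 : r != 0.
  by apply: contraTneq f_gt0 => r0; rewrite -rE r0 expr0n ltxx.
pose j := r^-1 *: f.
have ij : dot i j = 0 by rewrite linearZr_LR /= fi mulr0.
have jj : dot j j = 1.
  by rewrite linearZr_LR linearZl_LR /= -rE expr2 mulKf ?mulVf.
clearbody j.
have bas : basis_of fullv [:: i; j].
  rewrite basisEfree dimE subvf leqnn !andbT free_cons seq1_free span_seq1.
  apply/andP; split; last first.
    by apply: contraTneq (oner_neq0 K) => j0; rewrite -jj j0 linear0l eqxx.
  apply/negP => /vlineP[a ia]; move: ii.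
  by rewrite {1}ia linearZl_LR /= symd ij mulr0 => /esym/eqP; rewrite oner_eq0.
exists j; split=> // x.
have : x \in span [:: i; j] by rewrite (span_basis bas) memvf.
rewrite span_cons span_seq1 => /memv_addP[_ /vlineP[a ->] [_ /vlineP[b ->] ->]].
have -> : dot i (a *: i + b *: j) = a.
  by rewrite linearDr !linearZr_LR /= ii ij mulr1 mulr0 addr0.
have -> // : dot j (a *: i + b *: j) = b.
by rewrite linearDr !linearZr_LR /= jj symd ij mulr1 mulr0 add0r.
Qed.

(** * Cycles in coordinates *)

Section Hyperboloid.
Context (K : realFieldType) (K_euclidean : euclidean_field K).
Context (E : vectType K) (dot : {dot E for idfun}) (i j : E).
Hypotheses (ii : dot i i = 1) (jj : dot j j = 1) (ij : dot i j = 0).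
Hypothesis frameE : forall x, x = dot i x *: i + dot j x *: j.

Local Notation cycleT := (cycle_of K E).
Local Notation "<< m , n >>" := (cycle_pairing dot m n).
Local Notation p := (horizon i).
Local Notation H := (half_plane dot i).

Implicit Types (x y z d e l m n : cycleT) (u v w : H) (L M D R S X : set H).
Implicit Types (a b c r s t : K).

Lemma dot_coord (X Y : E) : dot X Y = dot i X * dot i Y + dot j X * dot j Y.
Proof. by rewrite [in LHS](frameE X) linearDl !linearZl_LR. Qed.

Lemma dotC (X Y : E) : dot X Y = dot Y X.
Proof. by rewrite hermC /= expr0 mul1r. Qed.

(** The coordinates on cycles are additive and homogeneous, so that an equality
    of cycles reduces to four equalities in K, settled by [ring] or [field]. *)
Definition cA x : K := x.1.1.
Definition cI x : K := dot i x.1.2.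
Definition cJ x : K := dot j x.1.2.
Definition cC x : K := x.2.

Lemma coordD x y :
  (((cA (x + y) = cA x + cA y)%R) * ((cI (x + y) = cI x + cI y)%R) *
   ((cJ (x + y) = cJ x + cJ y)%R) * ((cC (x + y) = cC x + cC y)%R))%type.
Proof. by rewrite /cI /cJ /= !linearDr. Qed.

Lemma coordN x :
  (((cA (- x) = - cA x)%R) * ((cI (- x) = - cI x)%R) *
   ((cJ (- x) = - cJ x)%R) * ((cC (- x) = - cC x)%R))%type.
Proof. by rewrite /cI /cJ /= !linearNr. Qed.

Lemma coordZ a x :
  (((cA (a *: x) = a * cA x)%R) * ((cI (a *: x) = a * cI x)%R) *
   ((cJ (a *: x) = a * cJ x)%R) * ((cC (a *: x) = a * cC x)%R))%type.
Proof. by rewrite /cI /cJ /= !linearZr_LR. Qed.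

Lemma coord0 :
  (((cA 0 = 0)%R) * ((cI 0 = 0)%R) * ((cJ 0 = 0)%R) * ((cC 0 = 0)%R))%type.
Proof. by rewrite /cI /cJ /= !linear0r. Qed.

Lemma coord_horizon :
  (((cA p = 0)%R) * ((cI p = 1)%R) * ((cJ p = 0)%R) * ((cC p = 0)%R))%type.
Proof. by rewrite /cI /cJ /= ii dotC ij. Qed.

Definition coordE := (coordD, coordN, coordZ, coord0, coord_horizon).

Lemma cycle_ext x y :
  cA x = cA y -> cI x = cI y -> cJ x = cJ y -> cC x = cC y -> x = y.
Proof.
case: x y => [[x1 x2] x3] [[y1 y2] y3].
rewrite /cA /cI /cJ /cC /= => -> eI eJ ->.
by rewrite (frameE x2) (frameE y2) eI eJ.
Qed.

Lemma pairing_coord x y : << x, y >> =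
  cI x * cI y + cJ x * cJ y - 2 * cA x * cC y - 2 * cA y * cC x.
Proof. by rewrite /cycle_pairing dot_coord. Qed.

Lemma pairingC x y : << x, y >> = << y, x >>.
Proof. by rewrite !pairing_coord; ring. Qed.

Lemma pairingDl x y z : << x + y, z >> = << x, z >> + << y, z >>.
Proof. by rewrite !pairing_coord !coordE; ring. Qed.

Lemma pairingDr x y z : << z, x + y >> = << z, x >> + << z, y >>.
Proof. by rewrite !pairing_coord !coordE; ring. Qed.

Lemma pairingZl a x z : << a *: x, z >> = a * << x, z >>.
Proof. by rewrite !pairing_coord !coordE; ring. Qed.

Lemma pairingZr a x z : << z, a *: x >> = a * << z, x >>.
Proof. by rewrite !pairing_coord !coordE; ring. Qed.

Lemma pairingNl x z : << - x, z >> = - << x, z >>.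
Proof. by rewrite !pairing_coord !coordE; ring. Qed.

Lemma pairingNr x z : << z, - x >> = - << z, x >>.
Proof. by rewrite !pairing_coord !coordE; ring. Qed.

Lemma pairing0l x : << 0, x >> = 0.
Proof. by rewrite !pairing_coord !coordE; ring. Qed.

Lemma pairing0r x : << x, 0 >> = 0.
Proof. by rewrite pairingC pairing0l. Qed.

Definition pairingE := (pairingDl, pairingDr, pairingZl, pairingZr,
  pairingNl, pairingNr, pairing0l, pairing0r).

Lemma horizon_norm : << p, p >> = 1.
Proof. by rewrite pairing_coord !coordE; ring. Qed.

Lemma pairing_horizonr x : << x, p >> = cI x.
Proof. by rewrite pairing_coord !coordE; ring. Qed.

(** The vector product of the 3-dimensional space orthogonal to the horizon,
    for its Lorentzian form: the index of the euclidean vector product of the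
    coordinates is raised with the inverse Gram matrix, the factor 2 making
    [cross_norm] hold without a constant. *)
Definition cross x y : cycleT :=
  (cJ x * cA y - cA x * cJ y, (2 * (cC x * cA y - cA x * cC y)) *: j,
   cC x * cJ y - cJ x * cC y).

Lemma coord_cross x y :
  (((cA (cross x y) = cJ x * cA y - cA x * cJ y)%R) *
   ((cI (cross x y) = 0)%R) *
   ((cJ (cross x y) = 2 * (cC x * cA y - cA x * cC y))%R) *
   ((cC (cross x y) = cC x * cJ y - cJ x * cC y)%R))%type.
Proof. by rewrite /cI /cJ /= !linearZr_LR /= ij jj mulr0 mulr1. Qed.

Lemma cross_horizon x y : << cross x y, p >> = 0.
Proof. by rewrite pairing_horizonr coord_cross. Qed.

Lemma crossl x y : << x, p >> = 0 -> << cross x y, x >> = 0.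
Proof.
by rewrite pairing_horizonr !pairing_coord !coord_cross => ->; ring.
Qed.

Lemma crossr x y : << y, p >> = 0 -> << cross x y, y >> = 0.
Proof.
by rewrite pairing_horizonr !pairing_coord !coord_cross => ->; ring.
Qed.

Lemma cross_norm x y : << x, p >> = 0 -> << y, p >> = 0 ->
  << cross x y, cross x y >> = << x, y >> ^+ 2 - << x, x >> * << y, y >>.
Proof.
rewrite !pairing_horizonr !pairing_coord !coord_cross => -> ->; ring.
Qed.

(** When x and y span a nondegenerate plane, the vectors x, y and their vector
    product form a basis of the 3-dimensional space orthogonal to p, and the
    coefficients of z are found by solving the Gram system.  Cleared of
    denominators, the identity is polynomial and holds for all x and y. *)
Lemma cross_expansion x y z : << x, p >> = 0 -> << y, p >> = 0 ->
  << z, p >> = 0 ->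
  (<< x, y >> ^+ 2 - << x, x >> * << y, y >>) *: z =
  << z, cross x y >> *: cross x y +
  (<< x, y >> * << z, y >> - << y, y >> * << z, x >>) *: x +
  (<< x, y >> * << z, x >> - << x, x >> * << z, y >>) *: y.
Proof.
rewrite !pairing_horizonr => xI yI zI.
by apply: cycle_ext; rewrite !pairing_coord !coordE !coord_cross xI yI zI; ring.
Qed.

(** * The hyperboloid *)

Definition height u : K := << p, q u >>.

Lemma coord_point u :
  (((cA (q u) = 1)%R) * ((cI (q u) = - 2 * dot i (val u))%R) *
   ((cJ (q u) = - 2 * dot j (val u))%R) *
   ((cC (q u) = dot i (val u) ^+ 2 + dot j (val u) ^+ 2)%R))%type.
Proof.
by rewrite /cI /cJ /= !linearZr_LR /cC /= (dot_coord (val u)) -!expr2.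
Qed.

Lemma height_gt0 u : 0 < height u.
Proof. by rewrite /height pairing_horizon_point_cycle; case: u. Qed.

(** The orthogonal projection of the isotropic cycle of u, scaled to pair to 1
    with p, onto the space orthogonal to p.  It is locked so that the
    bilinearity of the pairing does not expand it. *)
Definition hyperboloid_point : H -> cycleT :=
  locked (fun u => (height u)^-1 *: q u - p).
Local Notation h := hyperboloid_point.

Lemma hE u : h u = (height u)^-1 *: q u - p.
Proof. by rewrite /h -lock. Qed.

Lemma h_horizon u : << h u, p >> = 0.
Proof.
rewrite !hE !pairingE horizon_norm (pairingC _ p) -/(height u).
by rewrite mulVf ?subrr // gt_eqF ?height_gt0.
Qed.

Lemma qE u : q u = height u *: (h u + p).
Proof. by rewrite hE subrK scalerA mulfV ?scale1r // gt_eqF ?height_gt0. Qed.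

Lemma pairing_q x u : << x, p >> = 0 -> << x, q u >> = height u * << x, h u >>.
Proof. by move=> xp; rewrite qE !pairingE xp addr0. Qed.

(** Follows from <q u, q v> = - 2 |u - v|^2 and <p, p> = 1. *)
Lemma pairing_h u v :
  << h u, h v >> = - 1 - 2 * (dot i (val u - val v) ^+ 2 +
    dot j (val u - val v) ^+ 2) / (height u * height v).
Proof.
have u0 := gt_eqF (height_gt0 u); have v0 := gt_eqF (height_gt0 v).
rewrite !hE !pairingE horizon_norm (pairingC _ p) -/(height u) -/(height v).
rewrite pairing_coord !coord_point !linearBr /=.
by field; rewrite u0 v0.
Qed.

Lemma h_norm u : << h u, h u >> = -1.
Proof.
by rewrite pairing_h subrr !linear0r expr0n /= addr0 mulr0 mul0r subr0.
Qed.

Lemma pairing_h_le u v : << h u, h v >> <= -1.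
Proof.
have huv : 0 < height u * height v by rewrite mulr_gt0 ?height_gt0.
rewrite pairing_h gerDl oppr_le0 divr_ge0 ?(ltW huv) //.
by rewrite mulr_ge0 // addr_ge0 ?sqr_ge0.
Qed.

Lemma pairing_h_eq u v : << h u, h v >> = -1 -> u = v.
Proof.
move=> /eqP; rewrite pairing_h -subr_eq0 addrAC subrr add0r oppr_eq0.
have u0 := gt_eqF (height_gt0 u); have v0 := gt_eqF (height_gt0 v).
rewrite !mulf_eq0 invr_eq0 mulf_eq0 u0 v0 pnatr_eq0 /= orbF.
rewrite paddr_eq0 ?sqr_ge0 //.
rewrite !expf_eq0 /= => /andP[/eqP uvI /eqP uvJ].
apply: val_inj; apply/eqP; rewrite -subr_eq0.
by rewrite (frameE (_ - _)) uvI uvJ !scale0r addr0.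
Qed.

Lemma h_inj u v : h u = h v -> u = v.
Proof. by move=> uv; apply: pairing_h_eq; rewrite uv h_norm. Qed.

Lemma pairing_h_lt u v : u <> v -> << h u, h v >> < -1.
Proof.
move=> uv; rewrite lt_neqAle pairing_h_le andbT.
by apply/eqP => /pairing_h_eq.
Qed.

(** The cycle x + p is isotropic, hence a multiple of a point cycle by its
    leading coefficient; the vector u is read off from its linear part. *)
Lemma point_of_pos x :
  << x, p >> = 0 -> << x, x >> = -1 -> 0 < cA x -> exists u, h u = x.
Proof.
rewrite pairing_horizonr => xI xx a_gt0.
have a0 : cA x != 0 by rewrite gt_eqF.
have cE : cC x = (1 + cJ x ^+ 2) / (4 * cA x).
  move: xx; rewrite pairing_coord xI => xx.
  have -> : 1 + cJ x ^+ 2 = 4 * cA x * cC x by rewrite expr2; lra.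
  by field.
pose U : E := - (2 * cA x)^-1 *: (cJ x *: j + i).
have UI : dot i U = - (2 * cA x)^-1.
  by rewrite linearZr_LR linearDr linearZr_LR /= ij ii mulr0 add0r mulr1.
have UJ : dot j U = - (2 * cA x)^-1 * cJ x.
  by rewrite linearZr_LR linearDr linearZr_LR /= (dotC j i) ij jj mulr1 addr0.
have U_gt0 : 0 < - 2 * dot i U by rewrite UI mulrNN divr_gt0 ?mulr_gt0.
exists (exist _ U U_gt0); set u : H := exist _ _ _.
have heightE : height u = (cA x)^-1.
  by rewrite /height pairing_horizon_point_cycle /= UI; field.
apply: cycle_ext; rewrite hE !coordE !coord_point /= heightE invrK ?UI ?UJ.
- by rewrite mulr1 subr0.
- by rewrite xI; field.
- by field.
- by rewrite cE; field.
Qed.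

(** A cycle of norm -1 has a nonzero leading coefficient, whose sign tells the
    two sheets apart; on the sheet opposite to that of h v, the pairing with
    h v is at least 1. *)
Lemma point_exists x v :
  << x, p >> = 0 -> << x, x >> = -1 -> << x, h v >> < 0 -> exists u, h u = x.
Proof.
move=> xp xx xv.
case: (ltgtP 0 (cA x)) => [a_gt0|a_lt0|a0]; first exact: point_of_pos.
- have [u uE] : exists u, h u = - x.
    by apply: point_of_pos;
      rewrite ?pairingE ?xp ?xx ?opprK ?oppr0 ?coordE ?oppr_gt0.
  have := pairing_h_le u v; rewrite uE !pairingE => le_x; lra.
- move: xp xx; rewrite pairing_horizonr pairing_coord => -> xx.
  have := sqr_ge0 (cJ x); rewrite -a0 in xx; lra.
Qed.

(** A signature argument made explicit: solving the orthogonality to q u for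
    the constant term of x turns the norm of x into a sum of two squares. *)
Lemma tangent_norm_ge0 x u : << x, p >> = 0 -> << x, h u >> = 0 ->
  0 <= << x, x >> ?= iff (x == 0).
Proof.
move=> xp xu; have u_gt0 := height_gt0 u.
have xq : << x, q u >> = 0 by rewrite pairing_q // xu mulr0.
have uI : dot i (val u) != 0.
  by apply: contraTneq u_gt0; rewrite /height pairing_horizon_point_cycle => ->;
    rewrite mulr0 ltxx.
move: xp xq; rewrite pairing_horizonr !pairing_coord !coord_point => xI xq.
have xC : cC x = - (cJ x * dot j (val u)) -
    cA x * (dot i (val u) ^+ 2 + dot j (val u) ^+ 2).
  by move: xq; rewrite xI; lra.
have -> : cI x * cI x + cJ x * cJ x - 2 * cA x * cC x - 2 * cA x * cC x =
    (cJ x + 2 * cA x * dot j (val u)) ^+ 2 + (2 * cA x * dot i (val u)) ^+ 2.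
  by rewrite xI xC; ring.
apply/leifP; case: eqVneq => [->|x0].
  by rewrite !coordE !(mulr0, mul0r, addr0) expr0n /= addr0.
rewrite lt_neqAle addr_ge0 ?sqr_ge0 // andbT eq_sym paddr_eq0 ?sqr_ge0 //.
apply: contra x0; rewrite !expf_eq0 /= !mulf_eq0 (negPf uI) orbF pnatr_eq0 /=.
move=> /andP[/eqP yJ /eqP yA]; apply/eqP/cycle_ext; rewrite !coordE ?xC //.
- by move: yJ; rewrite yA mulr0 mul0r addr0.
- by move: yJ; rewrite yA !mulr0 !mul0r addr0 => ->; rewrite !mul0r oppr0 addr0.
Qed.

Lemma h_independent u v a b :
  u <> v -> a *: h u + b *: h v = 0 -> a = 0 /\ b = 0.
Proof.
move=> /pairing_h_lt uv ab0.
have eu : << a *: h u + b *: h v, h u >> = 0 by rewrite ab0 pairing0l.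
have ev : << a *: h u + b *: h v, h v >> = 0 by rewrite ab0 pairing0l.
move: eu ev; rewrite !pairingE !h_norm (pairingC (h v)).
set k := << h u, h v >> in uv *; move=> eu ev.
have aE : a = b * k by lra.
have : b * (k ^+ 2 - 1) = 0 by rewrite -ev aE; ring.
move/eqP; rewrite mulf_eq0 => /orP[/eqP b0|/eqP k0]; last by nra.
by rewrite aE b0 mul0r.
Qed.

(** * Tangent vectors and lines *)

(** Unit vectors of the tangent plane of the hyperboloid at h u. *)
Definition tangent u d : Prop :=
  [/\ << d, p >> = 0, << d, h u >> = 0 & << d, d >> = 1].

Lemma tangentN u d : tangent u d -> tangent u (- d).
Proof.
by case=> dp du dd; split; rewrite !pairingE ?dp ?du ?dd ?oppr0 ?opprK.
Qed.

Lemma tangent_cross u d : tangent u d -> tangent u (cross (h u) d).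
Proof.
case=> dp du dd; split; rewrite ?cross_horizon ?crossl ?h_horizon //.
by rewrite cross_norm ?h_horizon // (pairingC _ d) du dd h_norm; ring.
Qed.

Lemma tangent_expansion u d z : tangent u d -> << z, p >> = 0 ->
  z = - << z, h u >> *: h u + << z, d >> *: d +
      << z, cross (h u) d >> *: cross (h u) d.
Proof.
case=> dp du dd zp; have := cross_expansion (h_horizon u) dp zp.
rewrite (pairingC _ d) du dd h_norm expr0n /= => zE.
transitivity ((0 - -1 * 1 : K) *: z).
  by rewrite sub0r mulN1r opprK scale1r.
by rewrite zE; apply: cycle_ext; rewrite !coordE; ring.
Qed.

Lemma normalize x : 0 < << x, x >> ->
  exists2 r, 0 < r & << r *: x, r *: x >> = 1.
Proof.
move=> x_gt0; have [r r_ge0 rE] := sqrt_exists K_euclidean (ltW x_gt0).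
have r0 : r != 0 by apply: contraTneq x_gt0 => r0; rewrite -rE r0 expr0n ltxx.
exists r^-1; first by rewrite invr_gt0 lt_neqAle eq_sym r0.
by rewrite !pairingE -rE; field.
Qed.

Definition line_normal_to m : set H := [set u | << m, h u >> = 0].

(** A line contains a point u, so that its normal cycle is tangent at h u; being
    nonisotropic it has positive norm, and it can be scaled without changing
    its signs. *)
Lemma line_of_cycle_unit m L : line_of_cycle m L ->
  exists2 r, 0 < r &
    [/\ << r *: m, p >> = 0, << r *: m, r *: m >> = 1 &
        L = line_normal_to (r *: m)].
Proof.
case=> m0 mp -> [u /= mu].
have mh v : << m, q v >> = 0 <-> << m, h v >> = 0.
  rewrite pairing_q //; split=> [/eqP|->]; last by rewrite mulr0.
  by rewrite mulf_eq0 gt_eqF ?height_gt0 //= => /eqP.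
have m_gt0 : 0 < << m, m >>.
  rewrite lt_neqAle eq_sym m0 /=.
  by have [] := tangent_norm_ge0 mp ((mh u).1 mu).
have [r r_gt0 rm] := normalize m_gt0; exists r => //; split=> //.
  by rewrite pairingZl mp mulr0.
apply/predeqP => v /=; rewrite /line_normal_to /= pairingZl mh.
split=> [->|/eqP]; first by rewrite mulr0.
by rewrite mulf_eq0 gt_eqF //= => /eqP.
Qed.

Lemma line_unit L : is_line L ->
  exists m, [/\ << m, p >> = 0, << m, m >> = 1 & L = line_normal_to m].
Proof.
by case=> m /line_of_cycle_unit[r _ mL]; exists (r *: m).
Qed.

Lemma line_of_cycle_tangent u m : tangent u m ->
  line_of_cycle m (line_normal_to m).
Proof.
case=> mp mu mm; split=> //; first by rewrite /nonisotropic mm oner_neq0.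
  apply/predeqP => v /=; rewrite /line_normal_to /= pairing_q //.
  split=> [->|/eqP]; first by rewrite mulr0.
  by rewrite mulf_eq0 gt_eqF ?height_gt0 //= => /eqP.
by exists u.
Qed.

(** The geodesic through u in the direction d. *)
Definition line_along u d : set H := line_normal_to (cross (h u) d).

Lemma line_along_comb u d v a b : tangent u d ->
  h v = a *: h u + b *: d -> line_along u d v.
Proof.
move=> [dp _ _] vE.
by rewrite /line_along /line_normal_to /= vE pairingDr !pairingZr crossl ?crossr
  ?h_horizon // !mulr0 addr0.
Qed.

Lemma line_alongE u d v : tangent u d ->
  line_along u d v <-> h v = - << h v, h u >> *: h u + << h v, d >> *: d.
Proof.
move=> ud; split=> [uv|]; last exact: line_along_comb.
rewrite {1}(tangent_expansion ud (h_horizon v)) (pairingC _ (cross _ _)).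
by rewrite uv scale0r addr0.
Qed.

Lemma line_alongP u d v : tangent u d ->
  line_along u d v <-> exists a b, h v = a *: h u + b *: d.
Proof.
move=> ud; split=> [/(line_alongE v ud) vE|[a [b]]]; last exact: line_along_comb.
by exists (- << h v, h u >>), << h v, d >>.
Qed.

Lemma is_line_along u d : tangent u d -> is_line (line_along u d).
Proof.
by move=> /tangent_cross ud; exists (cross (h u) d); apply: line_of_cycle_tangent ud.
Qed.

Lemma line_along_base u d : tangent u d -> line_along u d u.
Proof. by move=> /tangent_cross[]. Qed.

Lemma line_normalE u d m : tangent u d -> tangent u m -> << m, d >> = 0 ->
  line_normal_to m = line_along u d.
Proof.
move=> ud [mp mu mm] md; have [_ _ cc] := tangent_cross ud.
have mE := tangent_expansion ud mp; rewrite md mu oppr0 !scale0r !add0r in mE.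
have c0 : << m, cross (h u) d >> != 0.
  apply/eqP => c0; move: mm; rewrite mE c0 scale0r pairing0l => /esym/eqP.
  by rewrite oner_eq0.
apply/predeqP => v; rewrite /line_along /line_normal_to /= mE pairingZl.
split=> [/eqP|->]; last by rewrite mulr0.
by rewrite mulf_eq0 (negPf c0) => /eqP.
Qed.

Lemma line_tangent L u : is_line L -> L u ->
  exists2 d, tangent u d & L = line_along u d.
Proof.
move=> /line_unit[m [mp mm ->]] mu; have um : tangent u m by [].
exists (cross (h u) m); first exact: tangent_cross.
by apply: line_normalE => //; [exact: tangent_cross | rewrite pairingC crossr].
Qed.

(** The coefficients a and b are the hyperbolic cosine and sine of the signed
    distance from u to v. *)
Lemma tangent_coef u d v a b : tangent u d -> h v = a *: h u + b *: d ->
  [/\ a = - << h v, h u >>, b = << h v, d >>, a ^+ 2 = 1 + b ^+ 2 & 1 <= a].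
Proof.
move=> [dp du dd] vE.
have aE : a = - << h v, h u >> by rewrite vE !pairingE du h_norm; ring.
split=> //; first by rewrite vE !pairingE dd (pairingC _ d) du; ring.
  have := h_norm v; rewrite vE !pairingE (pairingC _ d) du dd h_norm => /eqP.
  by move=> /eqP abE; rewrite !expr2; lra.
by rewrite aE lerNr; exact: pairing_h_le.
Qed.

(** The exponential map at u, parametrized by the hyperbolic sine s of the
    distance; on the opposite sheet the coefficient of h u is negative, so the
    nonnegative root of 1 + s^2 is taken. *)
Lemma exp_exists u d s : tangent u d ->
  exists v a, h v = a *: h u + s *: d.
Proof.
move=> [dp du dd].
have [a a_ge0 aE] : exists2 a, 0 <= a & a ^+ 2 = 1 + s ^+ 2.
  by apply: sqrt_exists; rewrite // addr_ge0 ?sqr_ge0.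
have a_gt0 : 0 < a.
  rewrite lt_neqAle a_ge0 andbT; apply/eqP => a0; move: aE (sqr_ge0 s).
  by rewrite -a0 expr0n /=; lra.
have [||| v vE] := @point_exists (a *: h u + s *: d) u.
- by rewrite !pairingE dp h_horizon !mulr0 addr0.
- rewrite !pairingE (pairingC _ d) du dd h_norm.
  by move: aE; rewrite !expr2; lra.
- by rewrite !pairingE du h_norm; lra.
by exists v, a.
Qed.

Lemma direction_exists u v : u <> v ->
  exists d a s, [/\ tangent u d, 0 < s & h v = a *: h u + s *: d].
Proof.
move=> uv; have k_lt := pairing_h_lt uv; set k := << h u, h v >> in k_lt.
pose d := h v + k *: h u.
have dd : << d, d >> = k ^+ 2 - 1.
  by rewrite /d !pairingE !h_norm (pairingC (h v)) -/k; ring.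
have d_gt0 : 0 < << d, d >> by rewrite dd; nra.
have [r r_gt0 rd] := normalize d_gt0.
exists (r *: d), (- k), r^-1; split; last 2 first.
- by rewrite invr_gt0.
- rewrite scalerA mulVf ?gt_eqF // scale1r.
  by rewrite /d; apply: cycle_ext; rewrite !coordE; ring.
split=> //; rewrite /d !pairingE ?h_horizon; first by ring.
by rewrite !h_norm (pairingC (h v)) -/k; ring.
Qed.

Lemma line_through u d L v a s : tangent u d -> s != 0 ->
  h v = a *: h u + s *: d -> is_line L -> L u -> L v -> L = line_along u d.
Proof.
move=> ud s0 vE /line_unit[m [mp mm ->]] mu mv; apply: line_normalE => //.
move: mv; rewrite /line_normal_to /= vE !pairingE mu mulr0 add0r => /eqP.
by rewrite mulf_eq0 (negPf s0) => /eqP.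
Qed.

(** A line is the trace of a plane through the origin. *)
Lemma lineP L u v : u <> v -> is_line L -> L u -> L v ->
  forall w, L w <-> exists a b, h w = a *: h u + b *: h v.
Proof.
move=> uv lineL Lu Lv w; have [d [a [s [ud s_gt0 vE]]]] := direction_exists uv.
have s0 : s != 0 by rewrite gt_eqF.
rewrite (line_through ud s0 vE lineL Lu Lv) line_alongP //.
split=> -[b [c ->]].
  exists (b - c / s * a), (c / s); rewrite vE.
  by apply: cycle_ext; rewrite !coordE; field.
exists (b + c * a), (c * s); rewrite vE.
by apply: cycle_ext; rewrite !coordE; ring.
Qed.

Lemma line_exists u v : u <> v -> exists L, [/\ is_line L, L u & L v].
Proof.
move=> /direction_exists[d [a [s [ud _ vE]]]]; exists (line_along u d).
split; first exact: is_line_along; first exact: line_along_base.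
by apply/line_alongP => //; exists a, s.
Qed.

(** The relation p = a q u + b q v + c q w, written with
    q u = <p, q u> (h u + p) and its analogues for v and w, splits into its component along p, which says that the rescaled coefficients
    add up to 1, and its component orthogonal to p, which is a linear relation
    between h u, h v and h w.  In the other direction a relation
    h v = a h u + b h w is rescaled by a + b - 1, which is negative because the
    triangle inequality is reversed for vectors of negative norm. *)
Lemma betweenP u v w : between u v w <->
  u <> w /\ exists a b, [/\ 0 < a, 0 < b & h v = a *: h u + b *: h w].
Proof.
have [[u_gt0 v_gt0] w_gt0] := (height_gt0 u, height_gt0 v, height_gt0 w).
split=> [[[uv vw uw] _ [a [b [c [[a0 b0 c0] pE ac ab]]]]]|].
  split=> //.
  have pE' : p = (a * height u) *: (h u + p) + (b * height v) *: (h v + p) +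
      (c * height w) *: (h w + p) by rewrite {1}pE !qE !scalerA.
  have sumE : a * height u + b * height v + c * height w = 1.
    have := congr1 (cycle_pairing dot p) pE'; rewrite !pairingE horizon_norm.
    by rewrite !(pairingC p) !h_horizon; lra.
  have ab_lt0 : a * b < 0 /\ c * b < 0.
    case: (ltgtP a 0) a0 b0 c0 ac ab => // a_s _ b0 c0;
      case: (ltgtP b 0) b0 => // b_s _; case: (ltgtP c 0) c0 => // c_s _;
      rewrite ?(gtr0_sg a_s) ?(ltr0_sg a_s) ?(gtr0_sg b_s) ?(ltr0_sg b_s)
        ?(gtr0_sg c_s) ?(ltr0_sg c_s) ?eqxx //; try (by move=> ? _; split; nra);
      move=> /eqP; lra.
  have bb : 0 < b ^+ 2 by rewrite exprn_even_gt0.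
  exists (- (a * b) * (height u / height v) / b ^+ 2),
    (- (c * b) * (height w / height v) / b ^+ 2).
  split; try by rewrite divr_gt0 // mulr_gt0 ?divr_gt0 // oppr_gt0; tauto.
  have relE : (a * height u) *: h u + (b * height v) *: h v +
      (c * height w) *: h w = 0.
    apply: (addIr p); rewrite add0r [RHS]pE' -{1}[p]scale1r -sumE.
    by apply: cycle_ext; rewrite !coordE; ring.
  have v0 := gt_eqF v_gt0.
  rewrite -[LHS]subr0 -(scaler0 _ (b * height v)^-1) -relE.
  by apply: cycle_ext; rewrite !coordE; field; rewrite b0 v0.
move=> [uw [a [b [a_gt0 b_gt0 vE]]]].
have uv : u <> v.
  move=> uv; have [] := @h_independent u w (a - 1) b uw; last by lra.
  by rewrite scalerBl scale1r {2}uv vE; apply: cycle_ext; rewrite !coordE; ring.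
have vw : v <> w.
  move=> vw; have [] := @h_independent u w a (b - 1) uw; last by lra.
  by rewrite scalerBl scale1r -{2}vw vE; apply: cycle_ext; rewrite !coordE; ring.
split; first by split.
  have [L [lineL Lu Lw]] := line_exists uw; exists L => //.
  have Lv : L v by apply/(lineP uw lineL Lu Lw); exists a, b.
  by move=> x [[]|] ->.
have ab_lt1 : a + b - 1 < 0.
  have := h_norm v; rewrite vE !pairingE !h_norm (pairingC (h w)).
  have := pairing_h_lt uw; set k := << h u, h w >> => k_lt abE.
  have sumE : (a + b) ^+ 2 = 1 + 2 * (a * b) * (k + 1) by rewrite expr2; lra.
  have : 0 < a * b * - (k + 1) by rewrite !mulr_gt0 // oppr_gt0; lra.
  nra.
have S0 : a + b - 1 != 0 by rewrite lt_eqF.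
have [[u0 v0] w0] := (gt_eqF u_gt0, gt_eqF v_gt0, gt_eqF w_gt0).
exists (a / (height u * (a + b - 1))), (- 1 / (height v * (a + b - 1))),
  (b / (height w * (a + b - 1))).
have num_lt0 r s : 0 < r -> 0 < s -> r / (s * (a + b - 1)) < 0.
  by move=> r0 s0; rewrite pmulr_rlt0 // invr_lt0 pmulr_rlt0.
have num_gt0 : 0 < - 1 / (height v * (a + b - 1)).
  by rewrite mulNr oppr_gt0 num_lt0.
rewrite (ltr0_sg (num_lt0 _ _ a_gt0 u_gt0)) (ltr0_sg (num_lt0 _ _ b_gt0 w_gt0)).
rewrite (gtr0_sg num_gt0); split=> //.
- by split; rewrite ?(gt_eqF num_gt0) // lt_eqF ?num_lt0.
- rewrite !qE vE; apply: cycle_ext; rewrite !coordE; field;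
    by rewrite S0 u0 v0 w0.
- by apply/eqP; lra.
Qed.

(** * Incidence *)

Lemma incidence1_holds : incidence1 dot i.
Proof.
move=> u v uv; have [L [lineL Lu Lv]] := line_exists uv; exists L; split=> //.
move=> M [lineM [Mu Mv]]; apply/predeqP => w.
by rewrite (lineP uv lineL Lu Lv) (lineP uv lineM Mu Mv).
Qed.

Lemma exp_neq u d v a s :
  tangent u d -> s != 0 -> h v = a *: h u + s *: d -> v <> u.
Proof.
move=> ud s0 vE vu; have [_ sE _ _] := tangent_coef ud vE.
by move: s0; rewrite sE vu pairingC; case: ud => _ -> _; rewrite eqxx.
Qed.

Lemma incidence2_holds : incidence2 dot i.
Proof.
move=> L lineL; have [u Lu] : L !=set0 by case: lineL => m [].
have [d ud ->] := line_tangent lineL Lu.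
have [v [a vE]] := exp_exists 1 ud; exists u, v; split.
- exact: line_along_base.
- exact: line_along_comb vE.
- by apply/nesym/(exp_neq ud _ vE); rewrite oner_neq0.
Qed.

(** The point - i and the tangent vector X |-> j.X there. *)
Lemma base_tangent_exists : exists u d, tangent u d.
Proof.
have u_gt0 : 0 < - 2 * dot i (- i) by rewrite (linearNr dot) /= ii mulrNN mulr1.
pose u : H := exist _ (- i) u_gt0; pose d : cycleT := (0, j, 0).
have dp : << d, p >> = 0.
  by rewrite pairing_coord !coordE /cI /= ij; ring.
exists u, d; split=> //.
- have : height u * << d, h u >> = 0.
    rewrite -pairing_q // pairing_coord !coord_point /cI /cJ /cA /cC /=.
    by rewrite ij jj !linearNr /= (dotC j i) ij; ring.
  by move/eqP; rewrite mulf_eq0 gt_eqF ?height_gt0 //= => /eqP.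
- by rewrite pairing_coord /cI /cJ /cA /cC /= ij jj; ring.
Qed.

(** A cycle orthogonal to h u and to the two perpendicular directions in which
    v and w are taken is a multiple of p, since these vectors and p form a
    basis. *)
Lemma incidence3_holds : incidence3 dot i.
Proof.
have [u [d ud]] := base_tangent_exists; have um := tangent_cross ud.
have dm : << cross (h u) d, d >> = 0 by rewrite crossr //; case: ud.
have [v [a vE]] := exp_exists 1 ud; have [w [b wE]] := exp_exists 1 um.
have one0 := oner_neq0 K.
exists u, v, w; split; first split.
- exact/nesym/(exp_neq ud one0 vE).
- move=> vw; have [_ e1 _ _] := tangent_coef ud vE.
  move: e1; rewrite vw wE !pairingE dm (pairingC _ d).
  by case: ud => _ -> _ /eqP; rewrite !mulr0 addr0 oner_eq0.
- exact/nesym/(exp_neq um one0 wE).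
move=> [L /line_unit[m [mp mm LE]] sub]; rewrite {}LE in sub.
have mu : << m, h u >> = 0 by apply: sub; left; left.
have mv : << m, h v >> = 0 by apply: sub; left; right.
have mw : << m, h w >> = 0 by apply: sub; right.
have m0 : m = 0.
  rewrite (tangent_expansion ud mp) mu.
  move: mv mw; rewrite vE wE !pairingE mu !mulr0 !add0r !mul1r => -> ->.
  by rewrite oppr0 !scale0r !addr0.
by move: mm; rewrite m0 pairing0l => /esym/eqP; rewrite oner_eq0.
Qed.

(** * Order *)

Lemma between_sym u v w : between u v w -> between w v u.
Proof.
move=> /betweenP[uw [a [b [a_gt0 b_gt0 vE]]]]; apply/betweenP.
by split; [exact: nesym | exists b, a; rewrite vE addrC].
Qed.

(** Substituting one positive relation into the other gives a relation between
    h v and h w whose second coefficient is positive, against their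
    independence. *)
Lemma between_excl u v w : between u v w -> ~ between v u w.
Proof.
move=> /betweenP[uw [a [b [a_gt0 b_gt0 vE]]]].
move=> /betweenP[vw [a' [b' [a'_gt0 b'_gt0 uE]]]].
have [|_ e] := @h_independent v w (a * a' - 1) (a * b' + b) vw.
  rewrite scalerBl scale1r {2}vE uE; apply: cycle_ext; rewrite !coordE; ring.
have : 0 < a * b' + b by rewrite addr_gt0 ?mulr_gt0.
by rewrite e ltxx.
Qed.

Lemma order1_holds : order1 dot i.
Proof. by move=> u v w _ _; exact: between_sym. Qed.

(** In a relation h w = a h u + b h v both coefficients are nonzero, and they
    are not both negative since all pairings of points are negative.  The three
    remaining sign patterns say which of the points is in the middle. *)
Lemma between_trichotomy u v w : distinct3 u v w -> collinear [set u; v; w] ->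
  [\/ between v u w, between u v w | between u w v].
Proof.
move=> [uv vw uw] [L lineL sub].
have [Lu Lv Lw] : [/\ L u, L v & L w].
  by split; apply: sub; [left; left | left; right | right].
have [a [b wE]] := (lineP uv lineL Lu Lv w).1 Lw.
have a0 : a != 0.
  apply/eqP => a0; have [] := @h_independent v w b (-1) vw; last by move=> _; lra.
  by rewrite wE a0; apply: cycle_ext; rewrite !coordE; ring.
have b0 : b != 0.
  apply/eqP => b0; have [] := @h_independent u w a (-1) uw; last by move=> _; lra.
  by rewrite wE b0; apply: cycle_ext; rewrite !coordE; ring.
have [wu wv] : << h w, h u >> = - a + b * << h u, h v >> /\
    << h w, h v >> = a * << h u, h v >> - b.
  by rewrite wE !pairingE !h_norm (pairingC (h v)); split; ring.
have := pairing_h_le w u; have := pairing_h_le w v; have := pairing_h_le u v.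
move: wu wv => -> ->; set k := << h u, h v >> => k_le av_le bu_le.
case: (ltgtP a 0) a0 => // a_s _; case: (ltgtP b 0) b0 => // b_s _.
- by suff : (1 : K) < 0 by [rewrite ltr10]; nra.
- apply: Or32; apply/betweenP; split=> //; exists (- a / b), (1 / b).
  by rewrite !divr_gt0 ?oppr_gt0 // wE; split=> //; apply: cycle_ext;
    rewrite !coordE; field; rewrite gt_eqF.
- apply: Or31; apply/betweenP; split=> //; exists (- b / a), (1 / a).
  by rewrite !divr_gt0 ?oppr_gt0 // wE; split=> //; apply: cycle_ext;
    rewrite !coordE; field; rewrite gt_eqF.
- by apply: Or33; apply/betweenP; split=> //; exists a, b.
Qed.

Lemma order2_holds : order2 dot i.
Proof.
move=> u v w duvw cuvw.
have [b|b|b] := between_trichotomy duvw cuvw.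
- apply: Or31; split=> //; first exact: between_excl b.
  by move=> c; apply: between_excl (between_sym b) c.
- apply: Or32; split=> //; first exact: between_excl b.
  by move=> c; apply: between_excl (between_sym b) (between_sym c).
- apply: Or33; split=> //.
    by move=> c; apply: between_excl b (between_sym c).
  by move=> c; apply: between_excl (between_sym b) (between_sym c).
Qed.

(** The point z is the image of y under the half-turn about x, that is
    h z = - 2 <h x, h y> h x - h y. *)
Lemma between_extend (x y : H) : x <> y -> exists z : H, between z x y.
Proof.
move=> xy; have := pairing_h_lt xy; set k := << h x, h y >> => k_lt.
have [||| z zE] := @point_exists (- (2 * k) *: h x - h y) x.
- by rewrite !pairingE !h_horizon; ring.
- by rewrite !pairingE !h_norm (pairingC (h y)) -/k; ring.
- by rewrite !pairingE !h_norm (pairingC (h y)) -/k; lra.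
have zy : z <> y.
  move=> zy; have [] := @h_independent x y (- (2 * k)) (-2) xy; last by move=> _; lra.
  have <- : - (2 * k) *: h x - h y - h y = 0 by rewrite -zE zy subrr.
  by apply: cycle_ext; rewrite !coordE; ring.
exists z; apply/betweenP; split=> //; exists (- (2 * k)^-1), (- (2 * k)^-1).
have k_lt0 : (2 * k)^-1 < 0 by rewrite invr_lt0; lra.
rewrite !oppr_gt0 zE; split=> //.
by apply: cycle_ext; rewrite !coordE; field; apply/eqP; lra.
Qed.

(** The midpoint, obtained by normalizing h x + h y, whose norm is
    - 2 + 2 <h x, h y>. *)
Lemma between_exists (x y : H) : x <> y -> exists z : H, between x z y.
Proof.
move=> xy; have := pairing_h_lt xy; set k := << h x, h y >> => k_lt.
have [|r r_gt0 rE] := @sqrt_exists K (2 - 2 * k) K_euclidean; first by lra.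
have r0 : r != 0 by apply/eqP => r0; move: rE; rewrite r0 expr0n /=; lra.
have r_gt : 0 < r by rewrite lt_neqAle eq_sym r0.
have [||| z zE] := @point_exists (r^-1 *: (h x + h y)) x.
- by rewrite !pairingE !h_horizon; ring.
- rewrite !pairingE !h_norm (pairingC (h y)) -/k.
  have -> : k = (2 - r ^+ 2) / 2 by lra.
  by field.
- by rewrite !pairingE !h_norm (pairingC (h y)) -/k pmulr_rlt0 ?invr_gt0 //; lra.
exists z; apply/betweenP; split=> //; exists r^-1, r^-1.
by rewrite !invr_gt0 zE scalerDr.
Qed.

Lemma order3_holds : order3 dot i.
Proof.
move=> s t L st lineL Ls Lt.
have [u ust] := between_extend st; have [v svt] := between_exists st.
have [w wts] := between_extend (nesym st); have stw := between_sym wts.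
have line_of (x y z : H) : between x y z -> (L x /\ L y -> L z) /\
    (L x /\ L z -> L y) /\ (L y /\ L z -> L x).
  move=> [[xy yz xz] [M lineM sub] _].
  have [Mx My Mz] : [/\ M x, M y & M z].
    by split; apply: sub; [left; left | left; right | right].
  have sameL (a b : H) : a <> b -> L a -> L b -> M a -> M b -> L = M.
    move=> ab La Lb Ma Mb; apply/predeqP => c.
    by rewrite (lineP ab lineL La Lb) (lineP ab lineM Ma Mb).
  split; first by move=> [Lx Ly]; rewrite (sameL x y).
  split; first by move=> [Lx Lz]; rewrite (sameL x z).
  by move=> [Ly Lz]; rewrite (sameL y z).
have [_ [_ Lu]] := line_of _ _ _ ust; have [_ [Lv _]] := line_of _ _ _ svt.
have [Lw _] := line_of _ _ _ stw.
exists u, v, w; split=> //; last by split; [apply: Lu | apply: Lv | apply: Lw].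
split.
- move=> uv; rewrite uv in ust; exact: between_excl ust svt.
- move=> vw; rewrite vw in svt.
  exact: between_excl (between_sym svt) (between_sym stw).
- move=> uw; rewrite uw in ust; exact: between_excl (between_sym ust) stw.
Qed.

(** The combination |s| h y + |r| h z, where r and s are the pairings of m with
    h y and h z, is orthogonal to m because r and s have opposite signs; it has
    negative norm, so it can be normalized to a point. *)
Lemma line_separates m (y z : H) : << m, p >> = 0 -> y <> z ->
  << m, h y >> * << m, h z >> < 0 ->
  exists2 t : H, line_normal_to m t & between y t z.
Proof.
move=> mp yz; set r := << m, h y >>; set s := << m, h z >> => rs.
have := pairing_h_lt yz; set k := << h y, h z >> => k_lt.
have r_neq0 : r != 0 by apply: contraTneq rs => ->; rewrite mul0r ltxx.
have s_neq0 : s != 0 by apply: contraTneq rs => ->; rewrite mulr0 ltxx.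
pose e : cycleT := `|s| *: h y + `|r| *: h z.
have [s_gt0 r_gt0] : 0 < `|s| /\ 0 < `|r| by rewrite !normr_gt0.
have sr_gt0 : 0 < `|s| * `|r| by rewrite mulr_gt0.
have ee : 0 < - << e, e >>.
  have -> : - << e, e >> = `|s| ^+ 2 + `|r| ^+ 2 + 2 * (`|s| * `|r|) * (- k).
    by rewrite /e !pairingE !h_norm (pairingC (h z)) -/k; ring.
  by rewrite !addr_gt0 ?exprn_gt0 // !mulr_gt0 // oppr_gt0; lra.
have [c c_ge0 cE] := sqrt_exists K_euclidean (ltW ee).
have c0 : c != 0 by apply: contraTneq ee => c0; rewrite -cE c0 expr0n ltxx.
have c_gt0 : 0 < c by rewrite lt_neqAle eq_sym c0.
have [||| t tE] := @point_exists (c^-1 *: e) y.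
- by rewrite /e !pairingE !h_horizon; ring.
- have eE : << e, e >> = - c ^+ 2 by rewrite cE opprK.
  by rewrite pairingZl pairingZr eE; field.
- rewrite pairingZl pmulr_rlt0 ?invr_gt0 //.
  rewrite /e !pairingE !h_norm (pairingC (h z)) -/k.
  nra.
have me : << m, e >> = 0.
  rewrite /e !pairingE -/r -/s.
  case: (ltgtP r 0) r_neq0 => // r_s _; case: (ltgtP s 0) s_neq0 => // s_s _;
    rewrite ?(gtr0_norm r_s) ?(ltr0_norm r_s) ?(gtr0_norm s_s) ?(ltr0_norm s_s);
    (ring || nra).
exists t; first by rewrite /line_normal_to /= tE pairingZr me mulr0.
apply/betweenP; split=> //; exists (c^-1 * `|s|), (c^-1 * `|r|).
by rewrite !mulr_gt0 ?invr_gt0 // tE scalerDr !scalerA.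
Qed.
(** The point x of M shows that u and v are on opposite sides of M, and w is on
    the side opposite to one of them. *)
Lemma order4_holds : order4 dot i.
Proof.
move=> u v w M [uv vw uw] /line_unit[m [mp mm ->]] Mu Mv Mw [x Mx].
move=> /betweenP[_ [a [b [a_gt0 b_gt0 xE]]]].
have mx : a * << m, h u >> + b * << m, h v >> = 0.
  by rewrite -!pairingZr -pairingDr -xE.
move: Mu Mv Mw; rewrite /line_normal_to /= => /eqP mu /eqP mv /eqP mw.
have uv_lt0 : << m, h u >> * << m, h v >> < 0.
  have v2 : 0 < << m, h v >> ^+ 2 by rewrite exprn_even_gt0.
  rewrite -(pmulr_rlt0 _ a_gt0).
  have -> : a * (<< m, h u >> * << m, h v >>) = - (b * << m, h v >> ^+ 2).
    have auE : a * << m, h u >> = - (b * << m, h v >>) by lra.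
    by rewrite mulrA auE; ring.
  by rewrite oppr_lt0 mulr_gt0.
case: (ltgtP (<< m, h u >> * << m, h w >>) 0) => [uw_lt0|uw_gt0|/eqP].
- by have [t Mt t_uw] := line_separates mp uw uw_lt0; exists t => //; left.
- have [|t Mt t_vw] := line_separates mp vw; last by exists t => //; right.
  move: mu mv mw uv_lt0 uw_gt0; set r := << m, h u >>; set s := << m, h v >>.
  set z := << m, h w >> => r0 _ _ rs rz.
  have r2 : 0 < r ^+ 2 by rewrite exprn_even_gt0.
  rewrite -(pmulr_rlt0 _ r2).
  have -> : r ^+ 2 * (s * z) = (r * s) * (r * z) by ring.
  by rewrite pmulr_llt0.
- by rewrite mulf_eq0 (negPf mu) (negPf mw).
Qed.

(** * Rays *)

Definition open_ray u d : set H :=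
  [set v | exists a s, 0 < s /\ h v = a *: h u + s *: d].

Definition closed_ray u d : set H := [set v | v = u \/ open_ray u d v].

Lemma open_rayE u d : tangent u d ->
  open_ray u d = [set v | [/\ line_along u d v, v <> u & 0 < << d, h v >>]].
Proof.
move=> ud; apply/predeqP => v; split=> [[a [s [s_gt0 vE]]]|[uv _ v_gt0]].
  split; first exact: line_along_comb vE.
    by apply: exp_neq ud _ vE; rewrite gt_eqF.
  by rewrite pairingC; have [_ <- _ _] := tangent_coef ud vE.
exists (- << h v, h u >>), << h v, d >>; rewrite pairingC; split=> //.
by rewrite (pairingC d); apply/(line_alongE v ud).
Qed.

Lemma open_ray_neq u d v : tangent u d -> open_ray u d v -> v <> u.
Proof. by move=> ud [a [s [s_gt0 vE]]]; apply: exp_neq ud _ vE; rewrite gt_eqF. Qed.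

Lemma tangent_line_along u d : tangent u d ->
  << d, cross (h u) d >> = 0.
Proof. by case=> dp _ _; rewrite pairingC crossr. Qed.

Lemma line_alongN u d : tangent u d -> line_along u (- d) = line_along u d.
Proof.
move=> ud; have und := tangentN ud.
apply: line_normalE => //; first exact: tangent_cross.
by rewrite -(opprK d) pairingNr pairingC opprK tangent_line_along ?oppr0.
Qed.

(** The cycle n that defines the two sides is orthogonal to p and to h u, hence
    has positive norm; up to sign its normalization is the direction d. *)
Lemma side_of_pointP L u D : side_of_point L u D ->
  exists d, [/\ tangent u d, L = line_along u d & D = open_ray u d].
Proof.
move=> [Lu [l [n [lL n0 [np nq nl]]]]].
have [r r_gt0 [rp rr LE]] := line_of_cycle_unit lL.
have nu : << n, h u >> = 0.
  move: nq; rewrite pairing_q // => /eqP.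
  by rewrite mulf_eq0 gt_eqF ?height_gt0 //= => /eqP.
have n_gt0 : 0 < << n, n >>.
  have [n_ge0 n_eq0] := tangent_norm_ge0 np nu.
  by rewrite lt_neqAle n_ge0 andbT n_eq0.
have [c c_gt0 cn] := normalize n_gt0.
have un : tangent u (c *: n).
  by split; rewrite // pairingZl ?np ?nu mulr0.
have um : tangent u (r *: l).
  by split=> //; move: Lu; rewrite LE.
have LE' : L = line_along u (c *: n).
  by rewrite LE; apply: line_normalE; rewrite // !pairingE (pairingC l) nl !mulr0.
have nposE v : (0 < << n, q v >>) = (0 < << c *: n, h v >>).
  by rewrite pairing_q // pairingZl !pmulr_rgt0 ?height_gt0.
have nnegE v : (<< n, q v >> < 0) = (0 < << - (c *: n), h v >>).
  by rewrite pairing_q // pairingNl pairingZl oppr_gt0 !pmulr_rlt0 ?height_gt0.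
case=> ->; [exists (c *: n)|exists (- (c *: n))]; split=> //.
- by rewrite open_rayE // -LE'; apply/predeqP => v /=; rewrite nposE.
- exact: tangentN.
- by rewrite line_alongN.
- rewrite open_rayE ?line_alongN -?LE' //; last exact: tangentN.
  by apply/predeqP => v /=; rewrite nnegE.
Qed.

Lemma side_of_point_ray u d : tangent u d ->
  side_of_point (line_along u d) u (open_ray u d).
Proof.
move=> ud; have uc := tangent_cross ud.
split; first exact: line_along_base.
have [dp du dd] := ud.
exists (cross (h u) d), d; split; first exact: line_of_cycle_tangent uc.
- by apply/eqP => d0; move: dd; rewrite d0 pairing0l => /esym/eqP; rewrite oner_eq0.
- by rewrite pairing_q // du mulr0 tangent_line_along.
- left; rewrite open_rayE //; apply/predeqP => v /=.
  by rewrite pairing_q // pmulr_rgt0 ?height_gt0.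
Qed.

(** The coefficient a only depends on u and v, hence so does s^2 = a^2 - 1. *)
Lemma direction_unique u d e v a b s t :
  tangent u d -> tangent u e -> 0 < s -> 0 < t ->
  h v = a *: h u + s *: d -> h v = b *: h u + t *: e -> d = e.
Proof.
move=> ud ue s_gt0 t_gt0 vE vE'.
have [aE _ a2 _] := tangent_coef ud vE; have [bE _ b2 _] := tangent_coef ue vE'.
have st : s = t.
  apply: sqr_inj_ge0; rewrite ?ltW //.
  by apply: (addrI 1); rewrite -a2 -b2 aE bE.
have : s *: d = s *: e.
  by apply: (addrI (a *: h u)); rewrite -vE st aE -bE.
by apply: scalerI; rewrite gt_eqF.
Qed.

Lemma rayE u d v : tangent u d -> open_ray u d v -> ray u v = closed_ray u d.
Proof.
move=> ud uv; apply/predeqP => w; split=> [[->|[L [D]]]|[->|uw]]; try by left.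
  move=> [_ _ /side_of_pointP[e [ue _ ->]] [a [s [s_gt0 vE]]] uw]; right.
  have [b [t [t_gt0 vE']]] := uv.
  by rewrite (direction_unique ud ue t_gt0 s_gt0 vE' vE).
right; exists (line_along u d), (open_ray u d); split=> //.
- exact: is_line_along.
- split; first exact: line_along_base.
  by move: uv; rewrite open_rayE // => -[].
- exact: side_of_point_ray.
Qed.

Lemma ray_direction u v : u <> v ->
  exists2 d, tangent u d & open_ray u d v.
Proof.
by move=> /direction_exists[d [a [s [ud s_gt0 vE]]]]; exists d => //; exists a, s.
Qed.

Lemma ray_fromP u R : ray_from u R <->
  exists2 d, tangent u d & R = closed_ray u d.
Proof.
split=> [[v /nesym/ray_direction[d ud uv] ->]|[d ud ->]].
  by exists d => //; apply: rayE.
have [v [a vE]] := exp_exists 1 ud.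
have uv : open_ray u d v by exists a, 1.
by exists v; [exact: open_ray_neq uv | rewrite (rayE ud uv)].
Qed.

(** The vertex is recovered because a ray does not extend beyond it: if u and v
    were distinct, a point w such that u is between w and v would be on the ray
    issuing from v, but not on the one issuing from u. *)
Lemma closed_ray_inj u v d e : tangent u d -> tangent v e ->
  closed_ray u d = closed_ray v e -> u = v /\ d = e.
Proof.
move=> ud ve de.
have uv : u = v.
  apply: contrapT => uv.
  have [/esym/uv//|[a [s [s_gt0 vE]]]] : closed_ray u d v by rewrite de; left.
  have [/uv//|[b [t [t_gt0 uE]]]] : closed_ray v e u by rewrite -de; left.
  have [w /betweenP[wv [x [y [x_gt0 y_gt0 uE']]]]] := between_extend uv.
  have wE : h w = x^-1 *: h u - (y / x) *: h v.
    by rewrite {1}uE'; apply: cycle_ext; rewrite !coordE; field; rewrite gt_eqF.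
  have : closed_ray u d w.
    rewrite de; right; exists (x^-1 * b - y / x), (x^-1 * t).
    rewrite mulr_gt0 ?invr_gt0 //; split=> //.
    by rewrite wE uE; apply: cycle_ext; rewrite !coordE; ring.
  have sE : << h w, d >> = - (y / x * s).
    rewrite wE vE !pairingE; case: ud => _ du dd.
    by rewrite (pairingC _ d) du dd; ring.
  have ys : 0 < y / x * s by rewrite mulr_gt0 ?divr_gt0.
  case=> [wu|[c [r [r_gt0 wE']]]].
    by move: sE; rewrite wu (pairingC _ d); case: ud => _ -> _ /esym/eqP;
      rewrite oppr_eq0 gt_eqF.
  have [_ rE _ _] := tangent_coef ud wE'.
  by move: r_gt0; rewrite rE sE oppr_gt0 ltNge (ltW ys).
rewrite -uv in ve de; split=> //.
have [w [a wE]] := exp_exists 1 ud.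
have [wu|[b [s [s_gt0 wE']]]] : closed_ray u e w.
- by rewrite -de; right; exists a, 1.
- by case: (exp_neq ud (oner_neq0 K) wE).
- exact: direction_unique wE wE'.
Qed.

(** * Congruence transformations *)

Definition realizes (T : {linear cycleT -> cycleT}) (g : H -> H) : Prop :=
  [/\ bijective T, forall m n, << T m, T n >> = << m, n >>, T p = p &
      forall u, T (h u) = h (g u)].

Lemma congruenceP (g : H -> H) :
  congruence_transformation g <-> exists T, realizes T g.
Proof.
split=> [[T [bijT isoT Tp Tpt] Tg]|[T [bijT isoT Tp Th]]].
  exists T; split=> // u; have [a a_gt0 Tq] := Tg u.
  have heightE : height u = a * height (g u).
    by rewrite /height -[LHS]isoT Tp Tq pairingZr.
  rewrite hE linearB linearZ /= Tp Tq heightE hE scalerA.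
  have [a0 gu0] := (gt_eqF a_gt0, gt_eqF (height_gt0 (g u))).
  by congr (_ *: _ - _); field; rewrite a0 gu0.
have Tq u : T (q u) = (height u / height (g u)) *: q (g u).
  rewrite (qE u) linearZ linearD /= Tp Th (qE (g u)) scalerA.
  by rewrite divfK // gt_eqF ?height_gt0.
have pos u : 0 < height u / height (g u) by rewrite divr_gt0 ?height_gt0.
exists T; first by split=> // u; exists (height u / height (g u)), (val (g u)).
by move=> u; exists (height u / height (g u)).
Qed.

Lemma realizes_congruence (T : {linear cycleT -> cycleT}) g :
  realizes T g -> congruence_transformation g.
Proof. by move=> Tg; apply/congruenceP; exists T. Qed.

Lemma realizes_exists (T : {linear cycleT -> cycleT}) :
  bijective T -> (forall m n, << T m, T n >> = << m, n >>) -> T p = p ->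
  (forall u, exists v, h v = T (h u)) -> exists g, realizes T g.
Proof.
by move=> bijT isoT Tp /choice[g gE]; exists g; split.
Qed.

Lemma realizes_id : exists T, realizes T id.
Proof.
exists (idfun : {linear cycleT -> cycleT}); by split=> //; exists idfun.
Qed.

Lemma realizes_comp (T1 T2 : {linear cycleT -> cycleT}) g1 g2 :
  realizes T1 g1 -> realizes T2 g2 ->
  realizes (T1 \o T2 : {linear cycleT -> cycleT}) (g1 \o g2).
Proof.
move=> [b1 i1 p1 h1] [b2 i2 p2 h2]; split=> /=.
- exact: bij_comp.
- by move=> m n; rewrite i1 i2.
- by rewrite p2 p1.
- by move=> u; rewrite h2 h1.
Qed.

(** The inverse isometry preserves the sheet, because it maps h u to a cycle
    whose pairing with h u is <h u, h (g u)>, which is negative. *)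
Lemma realizes_inv (T : {linear cycleT -> cycleT}) g : realizes T g ->
  exists T' g', [/\ realizes T' g', cancel T T', cancel T' T, cancel g g' &
                    cancel g' g].
Proof.
move=> [[T' TK T'K] isoT Tp Th].
pose lin := GRing.isLinear.Build K cycleT cycleT *:%R T' (can2_linear TK T'K).
pose S : {linear cycleT -> cycleT} := HB.pack T' lin.
have SE x : S x = T' x by [].
have isoS m n : << S m, S n >> = << m, n >> by rewrite -isoT !SE !T'K.
have Sp : S p = p by rewrite SE -{1}Tp TK.
have [||||g' Sg'] := @realizes_exists S => //.
- by exists T.
- move=> u; apply: (point_exists _ _ (v := u)).
  + by rewrite -Sp isoS h_horizon.
  + by rewrite isoS h_norm.
  + rewrite -isoT SE T'K Th.
    by have := pairing_h_le u (g u); lra.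
have [_ _ _ Sh] := Sg'.
exists S, g'; split=> // u; apply: h_inj.
- by rewrite -Sh -Th SE TK.
- by rewrite -Th -Sh SE T'K.
Qed.

Lemma realizes_pairing (T : {linear cycleT -> cycleT}) g u v : realizes T g ->
  << h (g u), h (g v) >> = << h u, h v >>.
Proof. by move=> [_ isoT _ Th]; rewrite -!Th isoT. Qed.

(** The image x of h u under the reflection satisfies
    <x, h u> = - 1 - 2 <h u, m>^2, so it stays on the sheet. *)
Lemma reflection_exists m : << m, p >> = 0 -> << m, m >> = 1 ->
  exists T g, realizes T g /\ forall x, T x = x - (2 * << x, m >>) *: m.
Proof.
move=> mp mm; pose f x : cycleT := x - (2 * << x, m >>) *: m.
have lin_f : linear f.
  move=> a x y; rewrite /f !pairingE.
  by apply: cycle_ext; rewrite !coordE; ring.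
have ff x : f (f x) = x.
  rewrite /f !pairingE mm.
  by apply: cycle_ext; rewrite !coordE; ring.
pose lin := GRing.isLinear.Build K cycleT cycleT *:%R f lin_f.
pose S : {linear cycleT -> cycleT} := HB.pack f lin.
have SE x : S x = x - (2 * << x, m >>) *: m by [].
have isoS x y : << S x, S y >> = << x, y >>.
  by rewrite !SE !pairingE mm (pairingC m); ring.
have [||||g Sg] := @realizes_exists S => //.
- by exists f.
- by rewrite SE pairingC mp mulr0 scale0r subr0.
- move=> u; apply: (point_exists _ _ (v := u)).
  + by rewrite SE !pairingE mp h_horizon; ring.
  + by rewrite isoS h_norm.
  + rewrite SE !pairingE h_norm (pairingC m).
    by have := sqr_ge0 << h u, m >>; rewrite expr2; lra.
by exists S, g.
Qed.

(** The reflection in the bisector of x and y, whose normal is h x - h y. *)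
Lemma swap_exists (x y : H) : x <> y ->
  exists T g, [/\ realizes T g, g x = y &
    forall z : H, << h z, h x >> = << h z, h y >> -> g z = z].
Proof.
move=> xy; have := pairing_h_lt xy; set k := << h x, h y >> => k_lt.
have dd : << h x - h y, h x - h y >> = - 2 * (1 + k).
  by rewrite !pairingE !h_norm (pairingC (h y)) -/k; ring.
have [|r r_gt0 rE] := @normalize (h x - h y); first by rewrite dd; lra.
have r2 : r ^+ 2 * (- 2 * (1 + k)) = 1.
  by rewrite -dd -rE [RHS]pairingZl pairingZr; ring.
have [||T [g [Tg TE]]] := @reflection_exists (r *: (h x - h y)) => //.
  by rewrite !pairingE !h_horizon; ring.
have [_ _ _ Th] := Tg; exists T, g; split=> // [|z zxy]; apply: h_inj.
- rewrite -Th TE !pairingE h_norm -/k.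
  transitivity (h x - (r ^+ 2 * (- 2 * (1 + k))) *: (h x - h y)).
    by apply: cycle_ext; rewrite !coordE; ring.
  by rewrite r2; apply: cycle_ext; rewrite !coordE; ring.
- by rewrite -Th TE !pairingE zxy subrr !mulr0 scale0r subr0.
Qed.

(** A first reflection moves u to x; a second one, in a bisector that passes
    through x, moves the image of v to y. *)
Lemma two_point_transitivity (u v x y : H) : << h u, h v >> = << h x, h y >> ->
  exists T g, [/\ realizes T g, g u = x & g v = y].
Proof.
move=> uvxy.
have move1 (a b : H) : exists T g, [/\ realizes T g, g a = b &
    forall z : H, << h z, h a >> = << h z, h b >> -> g z = z].
  have [->|ab] := pselect (a = b); last exact: swap_exists.
  by have [T Tid] := realizes_id; exists T, id.
have [T1 [g1 [Tg1 g1u _]]] := move1 u x.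
have [T2 [g2 [Tg2 g2v g2fix]]] := move1 (g1 v) y.
exists (T2 \o T1 : {linear cycleT -> cycleT}), (g2 \o g1); split=> //=.
  exact: realizes_comp.
rewrite g1u; apply: g2fix.
by rewrite -uvxy -g1u (realizes_pairing _ _ Tg1).
Qed.

Lemma segment_congruentP (u v x y : H) :
  segment_congruent u v x y <-> << h u, h v >> = << h x, h y >>.
Proof.
split=> [[g /congruenceP[T Tg] [<- <-]]|].
  by rewrite (realizes_pairing _ _ Tg).
move=> /two_point_transitivity[T [g [Tg gu gv]]].
by exists g => //; apply: realizes_congruence Tg.
Qed.

(** * Segments *)

(** As the triangle inequality is reversed for vectors of negative norm, the
    sum of the coefficients is at most 1. *)
Lemma segment_comb (u v x : H) : segment u v x ->
  exists a b, [/\ 0 <= a, 0 <= b, a + b <= 1 & h x = a *: h u + b *: h v].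
Proof.
case=> [->|->|/betweenP[_ [a [b [a_gt0 b_gt0 xE]]]]].
- by exists 1, 0; rewrite scale1r scale0r !addr0.
- by exists 0, 1; rewrite scale1r scale0r !add0r.
exists a, b; split=> //; try exact: ltW.
have := h_norm x; rewrite xE !pairingE !h_norm (pairingC (h v)).
have := pairing_h_le u v; set k := << h u, h v >> => k_le abE.
have ab : 0 <= a * b * - (k + 1).
  by rewrite mulr_ge0 ?mulr_ge0 ?(ltW a_gt0) ?(ltW b_gt0) // oppr_ge0; lra.
have sumE : (a + b) ^+ 2 <= 1.
  have -> : (a + b) ^+ 2 = 1 - 2 * (a * b * - (k + 1)) by rewrite expr2; lra.
  lra.
by rewrite -(@ler_pXn2r _ 2) ?expr1n // ?nnegrE ?ler01 // addr_ge0 ?ltW.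
Qed.

(** No two points of a segment are farther apart than its end points; this
    recovers the length of a segment from its set of points. *)
Lemma segment_diameter (u v x y : H) : segment u v x -> segment u v y ->
  << h u, h v >> <= << h x, h y >>.
Proof.
move=> /segment_comb[a [b [a_ge0 b_ge0 ab xE]]].
move=> /segment_comb[c [d [c_ge0 d_ge0 cd yE]]].
rewrite xE yE !pairingE !h_norm (pairingC (h v)).
have := pairing_h_le u v; set k := << h u, h v >> => k_le.
have prod_le1 : (a + b) * (c + d) <= 1 by rewrite mulr_ile1 ?addr_ge0.
have k1 : k <= (a + b) * (c + d) * k.
  have : 0 <= (1 - (a + b) * (c + d)) * - k by rewrite mulr_ge0 ?subr_ge0; lra.
  lra.
have : 0 <= (a * c + b * d) * - (k + 1).
  by rewrite mulr_ge0 ?addr_ge0 ?mulr_ge0 // oppr_ge0; lra.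
lra.
Qed.

Lemma congruence1_holds : congruence1 dot i.
Proof.
have ends (u v : H) : segment u v u /\ segment u v v.
  by split; [apply: Or31 | apply: Or32].
split=> [u v x y uvxy|u v u' v' x y]; rewrite !segment_congruentP.
  apply/eqP; rewrite eq_le; apply/andP; split; apply: segment_diameter.
  - by rewrite uvxy; case: (ends x y).
  - by rewrite uvxy; case: (ends x y).
  - by rewrite -uvxy; case: (ends u v).
  - by rewrite -uvxy; case: (ends u v).
by move=> -> ->.
Qed.

Lemma angle_congruent_sym R S R' S' :
  angle_congruent R S R' S' -> angle_congruent R' S' R S.
Proof.
move=> [g /congruenceP[T /realizes_inv[T' [g' [Tg' _ _ gK g'K]]]] [<- <-]].
exists g'; first exact: realizes_congruence Tg'.
have imK (A : set H) : g' @` (g @` A) = A.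
  apply/seteqP; split=> [_ [_ [v Av <-] <-]|v Av]; first by rewrite gK.
  by exists (g v); [exists v | exact: gK].
by rewrite !imK.
Qed.

Lemma angle_congruent_trans R S R' S' R'' S'' :
  angle_congruent R S R' S' -> angle_congruent R' S' R'' S'' ->
  angle_congruent R S R'' S''.
Proof.
move=> [g /congruenceP[T Tg] [<- <-]] [f /congruenceP[U Uf] [<- <-]].
exists (f \o g); last by rewrite !image_comp.
exact: realizes_congruence (realizes_comp Uf Tg).
Qed.

Lemma congruence2_holds : congruence2 dot i.
Proof.
split=> [R S _|R S R' S' R'' S'' _ _ _ RS /angle_congruent_sym].
  have [T Tid] := realizes_id; exists id; first exact: realizes_congruence Tid.
  by rewrite !image_id.
exact: angle_congruent_trans.
Qed.

(** The coefficient of the direction d in h t is the nonnegative square root of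
    <h u, h v>^2 - 1. *)
Lemma congruence3_holds : congruence3 dot i.
Proof.
move=> u v w L D uv lineL Lw /side_of_pointP[d [wd _ ->]].
have := pairing_h_lt uv; set k := << h u, h v >> => k_lt.
have [|s s_ge0 sE] := @sqrt_exists K (k ^+ 2 - 1) K_euclidean; first by nra.
have s0 : s != 0 by apply/eqP => s0; move: sE; rewrite s0 expr0n /=; nra.
have s_gt0 : 0 < s by rewrite lt_neqAle eq_sym s0.
have [t [a tE]] := exp_exists s wd.
have [aE _ a2 a_ge1] := tangent_coef wd tE.
have ak : a = - k.
  by apply: sqr_inj_ge0; rewrite ?a2 ?sE ?sqrrN; lra.
exists t; split; first split.
- by exists a, s.
- by apply/segment_congruentP; rewrite pairingC -/k -[LHS]opprK -aE ak opprK.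
move=> x [[b [r [r_gt0 xE]]] /segment_congruentP wx]; apply: h_inj.
have [bE _ b2 _] := tangent_coef wd xE.
have ba : a = b by rewrite ak bE pairingC wx.
have rs : s = r.
  apply: sqr_inj_ge0; rewrite ?ltW //.
  by apply: (addrI 1); rewrite -a2 -b2 ba.
by rewrite tE xE ba rs.
Qed.

Lemma segment_sym (u v x : H) : segment u v x -> segment v u x.
Proof.
by case=> [->|->|/between_sym b]; [apply: Or32 | apply: Or31 | apply: Or33].
Qed.

(** The coefficients of h v = (a - (s / t) b) h u + (s / t) h w are positive
    since s < t gives a / s > b / t: the hyperbolic cotangent decreases. *)
Lemma segment_initial u d v w a b s t : tangent u d ->
  0 < s -> s <= t -> h v = a *: h u + s *: d -> h w = b *: h u + t *: d ->
  segment u w v.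
Proof.
move=> ud s_gt0 st vE wE; have t_gt0 : 0 < t by exact: lt_le_trans st.
have [_ _ a2 a_ge1] := tangent_coef ud vE; have [_ _ b2 b_ge1] := tangent_coef ud wE.
have [vw|vw] := pselect (v = w); first exact: Or32.
have uw : u <> w by apply/nesym/(exp_neq ud _ wE); rewrite gt_eqF.
have lt_st : s < t.
  rewrite lt_neqAle st andbT; apply/eqP => e; apply: vw; apply: h_inj.
  rewrite vE wE e; congr (_ *: _ + _).
  by apply: sqr_inj_ge0; rewrite ?a2 ?b2 ?e //; lra.
apply: Or33; apply/betweenP; split=> //; exists (a - s / t * b), (s / t).
rewrite divr_gt0 // vE wE; split=> //; last first.
  by apply: cycle_ext; rewrite !coordE; field; rewrite gt_eqF.
have -> : a - s / t * b = (a * t - s * b) / t by field; rewrite gt_eqF.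
rewrite divr_gt0 // subr_gt0 -(@ltr_pXn2r _ 2) // ?nnegrE ?mulr_ge0 //; try lra.
rewrite !exprMn a2 b2; have : s ^+ 2 < t ^+ 2 by rewrite ltr_pXn2r ?nnegrE ?ltW.
lra.
Qed.

(** The addition formula cosh (x + y) = cosh x cosh y + sinh x sinh y, the
    pairings being minus the hyperbolic cosines.  If u and w were on the same
    side of v, one of the two segments would contain the other by
    [segment_initial], and they would have more than v in common. *)
Lemma segment_addition L (u v w : H) : is_line L -> L u -> L v -> L w ->
  segment u v `&` segment v w = [set v] ->
  exists s t, [/\ 0 <= s /\ 0 <= t, s ^+ 2 = << h u, h v >> ^+ 2 - 1,
    t ^+ 2 = << h v, h w >> ^+ 2 - 1 &
    << h u, h w >> = - (<< h u, h v >> * << h v, h w >>) - s * t].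
Proof.
move=> lineL Lu Lv Lw uvw.
have sq (x y : H) : exists2 s : K, 0 <= s & s ^+ 2 = << h x, h y >> ^+ 2 - 1.
  by apply: sqrt_exists => //; have := pairing_h_le x y; nra.
have [uv|uv] := pselect (u = v).
  have [t t_ge0 tE] := sq v w; exists 0, t; rewrite uv h_norm; split=> //; ring.
have [vw|vw] := pselect (v = w).
  have [s s_ge0 sE] := sq u v; exists s, 0; rewrite -vw h_norm; split=> //; ring.
have [d [a [s [vd s_gt0 uE]]]] := direction_exists (nesym uv).
have s0 : s != 0 by rewrite gt_eqF.
have := Lw; rewrite (line_through vd s0 uE lineL Lv Lu) line_alongP //.
move=> [b [t wE]].
have [aE _ a2 _] := tangent_coef vd uE; have [bE _ b2 _] := tangent_coef vd wE.
have t_le0 : t <= 0.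
  rewrite leNgt; apply/negP => t_gt0.
  have only_v (x : H) : segment u v x -> segment v w x -> x = v.
    by move=> ux wx; have : (segment u v `&` segment v w) x by []; rewrite uvw.
  case: (leP s t) => [st|/ltW ts].
    apply: uv; apply: only_v; first exact: Or31.
    exact: segment_initial vd s_gt0 st uE wE.
  apply/vw/esym/only_v; last exact: Or32.
  by apply: segment_sym; apply: segment_initial vd t_gt0 ts wE uE.
have t_eq : << h w, h v >> = - b by rewrite bE opprK.
have s_eq : << h u, h v >> = - a by rewrite aE opprK.
exists s, (- t); rewrite oppr_ge0 (pairingC (h v)) t_eq s_eq !sqrrN a2 b2.
split; [split=> //; exact: ltW | ring | ring |].
rewrite uE wE !pairingE h_norm; case: vd => _ du dd.
by rewrite (pairingC _ d) du dd; ring.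
Qed.

Lemma congruence4_holds : congruence4 dot i.
Proof.
move=> L M u v w x y z lineL lineM [Lu Lv Lw] [Mx My Mz] uvw xyz.
rewrite !segment_congruentP => xy yz.
have [s [t [[s_ge0 t_ge0] sE tE ->]]] := segment_addition lineL Lu Lv Lw uvw.
have [s' [t' [[s'_ge0 t'_ge0] s'E t'E ->]]] := segment_addition lineM Mx My Mz xyz.
have -> : s = s' by apply: sqr_inj_ge0; rewrite // sE s'E xy.
have -> : t = t' by apply: sqr_inj_ge0; rewrite // tE t'E yz.
by rewrite xy yz.
Qed.

(** * Angles *)

Lemma realizes_tangent (T : {linear cycleT -> cycleT}) g u d :
  realizes T g -> tangent u d -> tangent (g u) (T d).
Proof.
move=> [_ isoT Tp Th] [dp du dd]; split; last by rewrite isoT.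
  by have := isoT d p; rewrite Tp dp.
by rewrite -Th isoT.
Qed.

Lemma image_closed_ray (T : {linear cycleT -> cycleT}) g u d :
  realizes T g -> g @` closed_ray u d = closed_ray (g u) (T d).
Proof.
have sub (S : {linear cycleT -> cycleT}) f v e : realizes S f ->
    f @` closed_ray v e `<=` closed_ray (f v) (S e).
  move=> [_ _ _ Sh] _ [w [->|[a [s [s_gt0 wE]]]] <-]; [by left|right].
  by exists a, s; split=> //; rewrite -!Sh wE linearD !linearZ.
move=> Tg; have [T' [g' [Tg' TK _ gK g'K]]] := realizes_inv Tg.
apply/seteqP; split; first exact: sub.
move=> v uv; exists (g' v); last exact: g'K.
have : closed_ray (g' (g u)) (T' (T d)) (g' v).
  by apply: (sub T' g') => //; exists v.
by rewrite gK TK.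
Qed.

Lemma image_ray_inj (T : {linear cycleT -> cycleT}) g u d v e :
  realizes T g -> tangent u d -> tangent v e ->
  g @` closed_ray u d = closed_ray v e -> g u = v /\ T d = e.
Proof.
move=> Tg ud ve; rewrite (image_closed_ray _ _ Tg).
by apply: closed_ray_inj => //; apply: realizes_tangent.
Qed.

(** The points at the same distance from u along d and from v along e are moved
    to one another by [two_point_transitivity]. *)
Lemma tangent_transitivity u d v e : tangent u d -> tangent v e ->
  exists T g, [/\ realizes T g, g u = v & T d = e].
Proof.
move=> ud ve; have [x [a xE]] := exp_exists 1 ud; have [y [b yE]] := exp_exists 1 ve.
have [aE _ a2 a_ge1] := tangent_coef ud xE; have [bE _ b2 b_ge1] := tangent_coef ve yE.
have ab : a = b by apply: sqr_inj_ge0; rewrite ?a2 ?b2 //; lra.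
have [|T [g [Tg gu gx]]] := @two_point_transitivity u x v y.
  by apply: oppr_inj; rewrite !(pairingC (h u)) !(pairingC (h v)) -aE -bE.
exists T, g; split=> //; have [_ _ _ Th] := Tg.
apply: (addrI (b *: h v)); rewrite -[e in RHS]scale1r -yE -gx -Th xE.
by rewrite linearD !linearZ /= Th gu ab scale1r.
Qed.

Lemma frame_expansion u d m z : tangent u d -> tangent u m -> << m, d >> = 0 ->
  << z, p >> = 0 ->
  z = - << z, h u >> *: h u + << z, d >> *: d + << z, m >> *: m.
Proof.
move=> ud [mp mu mm] md zp; have [_ _ cc] := tangent_cross ud.
have mE := tangent_expansion ud mp; rewrite md mu oppr0 !scale0r !add0r in mE.
rewrite {1}(tangent_expansion ud zp); congr (_ + _).
set c := << m, _ >> in mE; have c2 : c * c = 1.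
  by move: mm; rewrite mE !pairingE cc mulr1.
by rewrite mE pairingZr scalerA mulrAC c2 mul1r.
Qed.

(** In the frame d, m of the tangent plane, the component along d of a unit
    vector determines the component along m up to its sign. *)
Lemma tangent_angle_unique u d m e f : tangent u d -> tangent u m ->
  << m, d >> = 0 -> tangent u e -> tangent u f -> << e, d >> = << f, d >> ->
  0 <= << e, m >> -> 0 <= << f, m >> -> e = f.
Proof.
move=> ud um md ue uf efd em_ge0 fm_ge0.
have sq x : tangent u x -> << x, m >> ^+ 2 = 1 - << x, d >> ^+ 2.
  move=> [xp xu xx].
  move: xx; rewrite {1}(frame_expansion ud um md xp) !pairingE xu.
  by rewrite (pairingC d) (pairingC m) !expr2; lra.
have em : << e, m >> = << f, m >>.
  by apply: sqr_inj_ge0; rewrite // !sq // efd.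
have [[ep eu _] [fp fu _]] := (ue, uf).
rewrite (frame_expansion ud um md ep) (frame_expansion ud um md fp).
by rewrite eu fu efd em.
Qed.

Lemma side_of_lineP L D : side_of_line L D ->
  exists m, [/\ << m, p >> = 0, << m, m >> = 1, L = line_normal_to m &
                D = [set u | 0 < << m, h u >>]].
Proof.
move=> [m lm DE]; have mp : << m, p >> = 0 by case: lm.
have [r r_gt0 [rp rr LE]] := line_of_cycle_unit lm.
have posE u : (0 < << m, q u >>) = (0 < << r *: m, h u >>).
  by rewrite pairing_q // pairingZl !pmulr_rgt0 ?height_gt0.
have negE u : (<< m, q u >> < 0) = (0 < << - (r *: m), h u >>).
  by rewrite pairing_q // pairingNl pairingZl oppr_gt0 !pmulr_rlt0 ?height_gt0.
case: DE => ->; [exists (r *: m)|exists (- (r *: m))]; split=> //.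
- by apply/predeqP => u /=; rewrite posE.
- by rewrite pairingNl rp oppr0.
- by rewrite pairingNl pairingNr opprK.
- rewrite LE; apply/predeqP => u; rewrite /line_normal_to /= pairingNl.
  by split=> [->|/eqP]; rewrite ?oppr0 // oppr_eq0 => /eqP.
- by apply/predeqP => u /=; rewrite negE.
Qed.

Lemma closed_ray_half_plane w e m : tangent w e -> tangent w m ->
  closed_ray w e `<=` line_normal_to m `|` [set u | 0 < << m, h u >>] <->
  0 <= << e, m >>.
Proof.
move=> we [mp mw mm]; split=> [sub|em_ge0 u].
  have [u [a uE]] := exp_exists 1 we.
  have muE : << m, h u >> = << e, m >>.
    by rewrite uE !pairingE mw (pairingC m); ring.
  rewrite -muE; have [] := sub u; first by right; exists a, 1.
    by rewrite /line_normal_to /= => ->.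
  by move=> /ltW.
case=> [->|[a [s [s_gt0 uE]]]]; first by left.
have muE : << m, h u >> = s * << e, m >>.
  by rewrite uE !pairingE mw (pairingC m); ring.
have : 0 <= << m, h u >> by rewrite muE mulr_ge0 // ltW.
rewrite le_eqVlt => /orP[/eqP mu0|mu_gt0]; [left|right]; last exact: mu_gt0.
exact: esym mu0.
Qed.

Lemma open_ray_half_plane w e m : tangent w e -> tangent w m ->
  closed_ray w e `\ w `<=` [set u | 0 < << m, h u >>] <-> 0 < << e, m >>.
Proof.
move=> we [mp mw mm]; split=> [sub|em_gt0 u].
  have [u [a uE]] := exp_exists 1 we.
  have muE : << m, h u >> = << e, m >>.
    by rewrite uE !pairingE mw (pairingC m); ring.
  rewrite -muE; apply: sub; split; first by right; exists a, 1.
  exact: exp_neq we (oner_neq0 K) uE.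
case=> -[-> []//|[a [s [s_gt0 uE]]]] _ /=.
by rewrite uE !pairingE mw mulr0 add0r (pairingC m) mulr_gt0.
Qed.

(** Existence: the angle is moved so that its first ray becomes the ray with
    direction t, and if its second direction e then points away from D, a
    reflection in L, which fixes t, corrects it.  Uniqueness: the pairing of e
    and t is prescribed, and so is the sign of the component of e along m.  When
    e is not strictly on the side D, it is a multiple of t and the given angle
    is null or straight. *)
Lemma congruence5_holds : congruence5 dot i.
Proof.
move=> R S w T0 L D [u /ray_fromP[r ur ->] /ray_fromP[s us ->]].
move=> /ray_fromP[t wt ->] lineL T_L /side_of_lineP[m [mp mm LE DE]].
rewrite {}LE {}DE in T_L *.
have mw : << m, h w >> = 0 by apply: T_L; left.
have wm : tangent w m by [].
have mt : << m, t >> = 0.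
  have [x [a xE]] := exp_exists 1 wt.
  have : line_normal_to m x by apply: T_L; right; exists a, 1.
  by rewrite /line_normal_to /= xE !pairingE mw mulr0 add0r mul1r.
have [e [we em_ge0 [T [g [Tg gu Tr Ts]]]]] : exists e, [/\ tangent w e,
    0 <= << e, m >> & exists T g, [/\ realizes T g, g u = w, T r = t & T s = e]].
  have [T [g [Tg gu Tr]]] := tangent_transitivity ur wt.
  have wTs : tangent w (T s) by rewrite -gu; apply: realizes_tangent.
  have [em_ge0|em_lt0] := leP 0 << T s, m >>.
    by exists (T s); split=> //; exists T, g.
  have [U [f [Uf UE]]] := reflection_exists mp mm.
  have fw : f w = w.
    apply: h_inj; have [_ _ _ <-] := Uf.
    by rewrite UE (pairingC _ m) mw mulr0 scale0r subr0.
  exists (U (T s)); split.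
  - by rewrite -fw; apply: realizes_tangent.
  - by rewrite UE !pairingE mm; lra.
  - exists (U \o T : {linear cycleT -> cycleT}), (f \o g).
    split=> //=; rewrite ?gu ?Tr //; first exact: realizes_comp.
    by rewrite UE (pairingC _ m) mt mulr0 scale0r subr0.
have cong_e : angle_congruent (closed_ray w t) (closed_ray w e)
    (closed_ray u r) (closed_ray u s).
  apply: angle_congruent_sym; exists g; first exact: realizes_congruence Tg.
  by rewrite !(image_closed_ray _ _ Tg) gu Tr Ts.
have unique X : ray_from w X ->
    angle_congruent (closed_ray w t) X (closed_ray u r) (closed_ray u s) ->
    X `<=` line_normal_to m `|` [set u | 0 < << m, h u >>] ->
    closed_ray w e = X.
  move=> /ray_fromP[f wf ->] [k /congruenceP[U Uk] [kt kf]].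
  move=> /(closed_ray_half_plane wf wm) fm_ge0.
  have [_ Ut] := image_ray_inj Uk wt ur kt; have [_ Uf] := image_ray_inj Uk wf us kf.
  suff -> : e = f by [].
  apply: (tangent_angle_unique wt wm mt we wf) => //.
  have [[_ isoT _ _] [_ isoU _ _]] := (Tg, Uk).
  by transitivity << s, r >>; [rewrite -Ts -Tr isoT | rewrite -Uf -Ut isoU].
have ray_e : ray_from w (closed_ray w e) by apply/ray_fromP; exists e.
split.
  exists (closed_ray w e); split; last by move=> X [wX congX subX]; exact: unique.
  by split=> //; apply/(closed_ray_half_plane we wm).
move=> noncol; have em_gt0 : 0 < << e, m >>.
  rewrite lt_neqAle em_ge0 andbT; apply/eqP => /esym em0; apply: noncol.
  have [ep eu _] := we.
  have eE : e = << e, t >> *: t.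
    rewrite {1}(frame_expansion wt wm mt ep) eu em0.
    by rewrite oppr0 !scale0r add0r addr0.
  have sE : s = << e, t >> *: r.
    have [[U TK _] _ _ _] := Tg.
    by apply: (can_inj TK); rewrite linearZ /= Ts Tr.
  exists (line_along u r); first exact: is_line_along.
  move=> x [] [->|[a [b [_ xE]]]]; try exact: line_along_base.
    exact: line_along_comb xE.
  by apply: (@line_along_comb u r x a (b * << e, t >>)) => //; rewrite xE sE scalerA.
exists (closed_ray w e); split.
  by split=> //; apply/(open_ray_half_plane we wm).
move=> X [wX congX subX]; apply: unique => // x Xx.
have [->|xw] := pselect (x = w); first by left.
by right; apply: subX.
Qed.

(** The transformation given by the congruence of angles already works: it maps
    the rays to the rays, and [tangent_coef] shows that a point on a ray is
    determined by its pairing with the vertex. *)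
Lemma congruence6_holds : congruence6 dot i.
Proof.
move=> u v w x y z [uv _ uw] _ [xy _ xz] _.
move=> /segment_congruentP uvxy /segment_congruentP uwxz.
have [d ud uv_d] := ray_direction uv; have [e ue uw_e] := ray_direction uw.
have [d' xd' xy_d'] := ray_direction xy; have [e' xe' xz_e'] := ray_direction xz.
rewrite (rayE ud uv_d) (rayE ue uw_e) (rayE xd' xy_d') (rayE xe' xz_e').
move=> [g /congruenceP[T Tg] [gd ge]].
have [gu Td] := image_ray_inj Tg ud xd' gd.
have [_ Te] := image_ray_inj Tg ue xe' ge.
have same (v1 y1 : H) f f' : tangent u f -> tangent x f' -> T f = f' ->
    open_ray u f v1 -> open_ray x f' y1 ->
    << h u, h v1 >> = << h x, h y1 >> -> g v1 = y1.
  move=> uf xf' Tf [a [s [s_gt0 vE]]] [b [t [t_gt0 yE]]] k_eq.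
  have [aE _ a2 _] := tangent_coef uf vE; have [bE _ b2 _] := tangent_coef xf' yE.
  have ab : a = b by rewrite aE bE (pairingC (h v1)) (pairingC (h y1)) k_eq.
  have st : s = t.
    apply: sqr_inj_ge0; rewrite ?ltW //.
    by apply: (addrI 1); rewrite -a2 -b2 ab.
  have [_ _ _ Th] := Tg; apply: h_inj.
  by rewrite -Th vE linearD !linearZ /= Th gu Tf yE ab st.
exists g; first exact: realizes_congruence Tg.
by split=> //; [apply: same ud xd' _ _ _ _ | apply: same ue xe' _ _ _ _].
Qed.

(** * Parallels *)

(** Let l be the unit normal of L, let d be the unit vector along the component
    of l orthogonal to h u, and let w be the tangent vector perpendicular to d.
    The line M t through u with normal d + t w would meet L in a point x with
    c^2 + (c^2 - t^2) <h x, w>^2 = 0, where c = <l, h u> is nonzero; hence it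
    misses L as soon as t^2 <= c^2.  The values t = c / (n + 1) give infinitely
    many such lines. *)
Lemma hyperbolic_parallel_holds : hyperbolic_parallel dot i.
Proof.
move=> L u /line_unit[l [lp ll ->]] Lu.
set c := << l, h u >>; have c0 : c != 0 by apply/eqP.
pose l0 := l + c *: h u.
have l0l0 : << l0, l0 >> = 1 + c ^+ 2.
  by rewrite /l0 !pairingE ll h_norm (pairingC (h u)) -/c; ring.
have c2 : 0 < c ^+ 2 by rewrite exprn_even_gt0.
have [|r r_gt0 rl] := @normalize l0; first by rewrite l0l0; lra.
have r2 : r ^+ 2 * (1 + c ^+ 2) = 1.
  by rewrite -l0l0 -rl [RHS]pairingZl pairingZr; ring.
pose d := r *: l0.
have ud : tangent u d.
  split; rewrite // /d /l0 !pairingE ?lp ?h_horizon; first by ring.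
  by rewrite h_norm -/c; ring.
have dE x : << x, d >> = r * (<< x, l >> + c * << x, h u >>).
  by rewrite /d /l0 !pairingE.
clearbody d; have uw := tangent_cross ud; set w := cross (h u) d in uw.
have dw : << d, w >> = 0 by exact: tangent_line_along.
pose M (t : K) := line_normal_to (d + t *: w).
have M_line t : is_line (M t).
  have [[dp du dd] [wp wu ww]] := (ud, uw).
  have [|a a_gt0 aa] := @normalize (d + t *: w).
    rewrite !pairingE (pairingC w d) dw dd ww.
    by have := sqr_ge0 t; rewrite expr2; lra.
  exists (a *: (d + t *: w)).
  have -> : M t = line_normal_to (a *: (d + t *: w)).
    apply/predeqP => v; rewrite /M /line_normal_to /= pairingZl.
    split=> [->|/eqP]; first by rewrite mulr0.
    by rewrite mulf_eq0 gt_eqF //= => /eqP.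
  apply: (@line_of_cycle_tangent u); split=> //.
    by rewrite !pairingE dp wp; ring.
  by rewrite !pairingE du wu; ring.
have M_u t : M t u.
  have [[_ du _] [_ wu _]] := (ud, uw).
  by rewrite /M /line_normal_to /= !pairingE du wu; ring.
have M_disjoint t : t ^+ 2 <= c ^+ 2 -> M t `&` line_normal_to l = set0.
  move=> tc; apply/predeqP => x; split=> // -[]; rewrite /M /line_normal_to /=.
  rewrite !pairingE => mx lx.
  set f := << h x, h u >>; set y := << h x, w >>.
  have dxE : << h x, d >> = r * c * f.
    by rewrite dE (pairingC _ l) lx -/f; ring.
  have ty : r * c * f = - (t * y).
    by move: mx; rewrite (pairingC d) (pairingC w) dxE -/y; lra.
  have f2 : f ^+ 2 = 1 + (t * y) ^+ 2 + y ^+ 2.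
    have := h_norm x; rewrite {1}(tangent_expansion ud (h_horizon x)) !pairingE.
    rewrite (pairingC (h u)) (pairingC d) (pairingC w) -/f -/w -/y dxE ty.
    by rewrite !expr2; lra.
  have cf : c ^+ 2 * f ^+ 2 = (1 + c ^+ 2) * (t * y) ^+ 2.
    rewrite -(sqrrN (t * y)) -ty.
    transitivity (r ^+ 2 * (1 + c ^+ 2) * (c ^+ 2 * f ^+ 2)); last by ring.
    by rewrite r2 mul1r.
  have : 0 < c ^+ 2 + (c ^+ 2 - t ^+ 2) * y ^+ 2.
    by rewrite ltr_wpDr // mulr_ge0 ?sqr_ge0 // subr_ge0.
  suff -> : c ^+ 2 + (c ^+ 2 - t ^+ 2) * y ^+ 2 = 0 by rewrite ltxx.
  by move: cf; rewrite f2 exprMn; lra.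
have M_inj : injective M.
  move=> t t' tt'; have [e ue ME] := line_tangent (M_line t) (M_u t).
  have [v [a vE]] := exp_exists 1 ue.
  have vu : v <> u by apply: exp_neq ue (oner_neq0 K) vE.
  have Mv : M t v by rewrite ME; apply: line_along_comb vE.
  have Mv' : M t' v by rewrite -tt'.
  apply: contrapT => t_neq.
  move: Mv Mv'; rewrite /M /line_normal_to /= !pairingE => e1 e2.
  have wv : << w, h v >> = 0.
    have /eqP : (t - t') * << w, h v >> = 0 by lra.
    by rewrite mulf_eq0 subr_eq0 => /orP[/eqP//|/eqP].
  have dv : << d, h v >> = 0 by move: e1; rewrite wv mulr0 addr0.
  have := tangent_expansion ud (h_horizon v).
  rewrite -/w !(pairingC (h v)) dv wv !scale0r !addr0 => vE'.
  have [] := @h_independent v u 1 << h u, h v >> vu.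
    by rewrite scale1r {1}vE' scaleNr addNr.
  by move/eqP; rewrite oner_eq0.
pose N (n : nat) := M (c / n.+1%:R).
have N_inj : injective N.
  move=> n n' /M_inj /(mulfI c0) /invr_inj /eqP.
  by rewrite eqr_nat => /eqP[].
have N_par (n : nat) : parallels_through (line_normal_to l) u (N n).
  split; [exact: M_line | exact: M_u | apply: M_disjoint].
  rewrite expr_div_n ler_pdivrMr ?exprn_gt0 ?ltr0Sn //.
  by rewrite ler_peMr ?sqr_ge0 // exprn_ege1 // ler1n.
split.
  by exists (N 0), (N 1); split=> // /N_inj.
move=> fin; apply: infinite_nat.
apply: sub_finite_set (finite_preimage (f := N) _ fin).
  by move=> n _; exact: N_par.
by move=> ? ? _ _; exact: N_inj.
Qed.

End Hyperboloid.

Theorem mainTheorem1 (K : realFieldType) (K_euclidean : euclidean_field K)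
  (E : vectType K) (dimE : \dim {:E} = 2%N)
  (dot : {dot E for idfun}) (i : E) (i_unit : dot i i = 1) :
  [/\ incidence1 dot i, incidence2 dot i & incidence3 dot i] /\
  [/\ order1 dot i, order2 dot i, order3 dot i & order4 dot i] /\
  ([/\ congruence1 dot i, congruence2 dot i & congruence3 dot i] /\
   [/\ congruence4 dot i, congruence5 dot i & congruence6 dot i]) /\
  hyperbolic_parallel dot i.
Proof.
have [j [jj ij frameE]] := orthonormal_complement K_euclidean dimE i_unit.
split; first by split;
  [ apply: incidence1_holds frameE | apply: incidence2_holds frameE
  | apply: incidence3_holds frameE].
split; first by split; [ apply: order1_holds frameE | apply: order2_holds frameE
  | apply: order3_holds frameE | apply: order4_holds frameE].
split; last exact: hyperbolic_parallel_holds frameE.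
split; split.
- exact: congruence1_holds frameE.
- exact: congruence2_holds frameE.
- exact: congruence3_holds frameE.
- exact: congruence4_holds frameE.
- exact: congruence5_holds frameE.
- exact: congruence6_holds frameE.
Qed.
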